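(* For $1\le n_1\le N$, $1\le n_2\le N-1$ and $x_1,x_2\in\mathbb{Z}$ put $$K(x_1,n_1;x_2,n_2)=-1_{n_2<n_1}1_{x_2\le x_1}\frac{(x_1-x_2+1)_{n_1-n_2-1}}{(n_1-n_2-1)!}$$ $$+\frac{(N-n_1)!}{(N-n_2-1)!}\frac{1}{(2\pi \mathrm{i})^2}\oint_{\{z\}}dz\oint_{\{w\}}dw\,\frac{(z-x_2+1)_{N-n_2-1}}{(w-x_1)_{N-n_1+1}}\,\frac{1}{w-z}\prod_{i=1}^{k}\frac{(A_i+\frac12-w)_{B_i-A_i}}{(A_i+\frac12-z)_{B_i-A_i}} .$$ Here the contours in $z$ and $w$ are positively (counter-clockwise) oriented and do not intersect; the contour $\{z\}$ encircles the integer points $x_2,x_2+1,\dots,B_k-\frac12$ and only them (i.e. it does not contain $x_2-1,x_2-2,\dots$); the contour $\{w\}$ contains $\{z\}$ and all the points $x_1,x_1-1,\dots,x_1-(N-n_1)$. Then $K$ is a correlation kernel of the measure $\mathbb{P}_{\mathbf P}$: for every $s\ge1$ and all pairwise distinct points $(x_1,n_1),\dots,(x_s,n_s)$ with $x_i\in\mathbb{Z}$, $1\le n_i\le N-1$, $$\rho_s(x_1,n_1;\dots;x_s,n_s)=\det[K(x_i,n_i;x_j,n_j)]_{i,j=1}^s .$$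
   Context: Fix integers $k\ge2$, $N\ge1$ and proper half-integers $A_1<B_1<A_2<B_2<\dots<A_k<B_k$ in $\mathbb{Z}+\frac12$ with $\sum_{i=1}^k(B_i-A_i)=N$. Let $\mathsf{x}^N_N<\dots<\mathsf{x}^N_1$ be the increasing enumeration of the $N$ integers in $\bigcup_{i=1}^k\{A_i+\frac12,A_i+\frac32,\dots,B_i-\frac12\}$. $\mathbb{P}_{\mathbf P}$ is the uniform probability measure on the (finite) set of integer arrays $\mathsf{X}=\{\mathsf{x}^m_j: m=1,\dots,N,\ j=1,\dots,m\}$ with this fixed top row $m=N$ satisfying the interlacing constraints $\mathsf{x}^m_{j+1}<\mathsf{x}^{m-1}_j\le \mathsf{x}^m_j$ for all $j,m$ for which they make sense. (These arrays are in bijection with lozenge tilings of a polygon $\mathbf P$ with $3k$ sides determined by $A_i,B_i$, the particle at $(\mathsf{x}^m_j,m)$ marking the center of a lozenge of one of the three types, so $\mathbb{P}_{\mathbf P}$ is the uniform measure on tilings of $\mathbf P$.) The correlation functions are $\rho_s(x_1,n_1;\dots;x_s,n_s):=\mathbb{P}_{\mathbf P}(\text{for every } i=1,\dots,s \text{ there is a particle at } (x_i,n_i))$, i.e. $x_i\in\{\mathsf{x}^{n_i}_1,\dots,\mathsf{x}^{n_i}_{n_i}\}$ for all $i$. Notation: $1_{\{\cdot\}}$ is an indicator; $(y)_m:=y(y+1)\cdots(y+m-1)$ for $m\ge1$ and $(y)_0:=1$ is the Pochhammer symbol. The first summand of $K$ is understood as $0$ when $n_2\ge n_1$. *)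

(* Defs.v *)
From HB Require Import structures.
From mathcomp Require Import all_boot all_order all_algebra.
From mathcomp Require Import finmap.
From mathcomp Require Import all_classical all_reals all_analysis.
From mathcomp Require Import complex.
Set Implicit Arguments.
Unset Strict Implicit.
Unset Printing Implicit Defensive.
Import Order.TTheory GRing.Theory Num.Theory.
Import numFieldNormedType.Exports.
Local Open Scope classical_set_scope.
Local Open Scope ring_scope.
Local Open Scope complex_scope.

Definition pochhammer (F : nzRingType) (y : F) (m : nat) : F :=
  \prod_(l < m) (y + l%:R).

Definition half_integer (a : rat) : Prop := a - 2^-1 \is a Num.int.

Definition C1_on (R : realType) (f : R -> R) (a b : R) : Prop :=
  derivable_oo_LRcontinuous f a b /\
  exists2 f' : R -> R, {within `[a, b], continuous f'} &
                       {in `]a, b[, derive1 f =1 f'}.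

(* [path <%R 0 s] and [last 0 s = 1] say that 0 :: s is a subdivision
   0 = t_0 < t_1 < ... < t_n = 1; continuity on the whole of [0, 1] follows
   from the one-sided continuity at the ends of each piece in [C1_on]. *)
Definition piecewise_C1 (R : realType) (g : R -> R[i]) : Prop :=
  exists s : seq R,
    [/\ path <%R 0 s, last 0 s = 1 &
        forall i, (i < size s)%N ->
          C1_on (fun t => complex.Re (g t)) (nth 0 (0 :: s) i) (nth 0 s i) /\
          C1_on (fun t => complex.Im (g t)) (nth 0 (0 :: s) i) (nth 0 s i)].

Definition trace_of (R : realType) (g : R -> R[i]) : set R[i] :=
  g @` `[0, 1].

(* At the finitely many corners of a piecewise C1 curve the value is a junk
   value, which the integral below does not see. *)
Definition velocity (R : realType) (g : R -> R[i]) (t : R) : R[i] :=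
  derive1 (fun u => complex.Re (g u)) t +i* derive1 (fun u => complex.Im (g u)) t.

Definition contour_integral (R : realType) (g : R -> R[i])
    (f : R[i] -> R[i]) : R[i] :=
  (\int[@lebesgue_measure R]_(t in `[0, 1]) complex.Re (f (g t) * velocity g t))%R +i*
  (\int[@lebesgue_measure R]_(t in `[0, 1]) complex.Im (f (g t) * velocity g t))%R.

Definition two_pi_i (R : realType) : R[i] := 0 +i* (2 * pi).

Definition winding_number (R : realType) (g : R -> R[i]) (p : R[i]) : R[i] :=
  (two_pi_i R)^-1 * contour_integral g (fun z => (z - p)^-1).

(* A simple closed curve winds around each point of its interior +1 or -1 times
   according to its orientation, and 0 times around the exterior points; hence
   the last clause is counter-clockwise orientation. *)
Definition positive_contour (R : realType) (g : R -> R[i]) : Prop :=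
  [/\ piecewise_C1 g,
      g 0 = g 1,
      {in `[0, 1[ &, injective g} &
      forall p, ~ trace_of g p -> winding_number g p = 0 \/
                                  winding_number g p = 1].

Definition inside (R : realType) (g : R -> R[i]) : set R[i] :=
  [set p | ~ trace_of g p /\ winding_number g p = 1].

Definition outside (R : realType) (g : R -> R[i]) : set R[i] :=
  [set p | ~ trace_of g p /\ winding_number g p = 0].

(* [A] and [B] are 1-based: only their values at 1 <= i <= k matter. *)
Definition admissible_contours (R : realType) (k N : nat) (B : nat -> rat)
    (x1 : int) (n1 : nat) (x2 : int) (gz gw : R -> R[i]) : Prop :=
  [/\ positive_contour gz /\ positive_contour gw,
      trace_of gz `&` trace_of gw = set0,
      forall m : int,
        if (x2 <= m) && (m%:~R <= B k - 2^-1) then inside gz m%:~R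
        else outside gz m%:~R,
      trace_of gz `<=` inside gw &
      forall j : nat, (j <= N - n1)%N -> inside gw (x1 - j%:Z)%:~R].

(* For n2 >= n1 the subtraction n1 - n2 - 1 truncates to 0, but then the
   first summand vanishes. [Num.truncn] only casts the natural number B i - A i
   from rat to nat. *)
Definition corr_kernel (R : realType) (k N : nat) (A B : nat -> rat)
    (gz gw : R -> R[i]) (x1 : int) (n1 : nat) (x2 : int) (n2 : nat) : R[i] :=
  - ((n2 < n1)%N%:R * (x2 <= x1)%R%:R *
     (pochhammer (x1 - x2 + 1)%:~R (n1 - n2 - 1) / (n1 - n2 - 1)`!%:R))
  + (N - n1)`!%:R / (N - n2 - 1)`!%:R * ((two_pi_i R) ^+ 2)^-1 *
    contour_integral gz (fun z => contour_integral gw (fun w =>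
      pochhammer (z - x2%:~R + 1) (N - n2 - 1)
        / pochhammer (w - x1%:~R) (N - n1 + 1)
      * (w - z)^-1
      * \prod_(1 <= i < k.+1)
          (pochhammer (ratr (A i + 2^-1) - w) (Num.truncn (B i - A i))
           / pochhammer (ratr (A i + 2^-1) - z) (Num.truncn (B i - A i))))).

(* p = (m, j) is the position of the entry x^m_j; both indices are 1-based. *)
Definition site (N : nat) : Type :=
  {p : 'I_N.+1 * 'I_N.+1 | (1 <= p.2 <= p.1)%N}.

Definition row_of (N : nat) (p : site N) : nat := (val p).1.
Definition pos_of (N : nat) (p : site N) : nat := (val p).2.

Definition array (N : nat) : Type := {ffun site N -> int}.

Definition interlacing (N : nat) (X : array N) : Prop :=
  forall p q : site N, row_of q = (row_of p).+1 ->
    (pos_of q = (pos_of p).+1 -> X q < X p) /\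
    (pos_of q = pos_of p -> X p <= X q).

Definition has_top_row (k N : nat) (A B : nat -> rat) (X : array N) : Prop :=
  (forall p q : site N, row_of p = N -> row_of q = N -> (pos_of p < pos_of q)%N ->
     X q < X p) /\
  (forall x : int,
     (exists2 p : site N, row_of p = N & X p = x) <->
     (exists2 i : nat, (1 <= i <= k)%N &
        A i + 2^-1 <= x%:~R <= B i - 2^-1)).

Definition arrays (k N : nat) (A B : nat -> rat) : set (array N) :=
  [set X | has_top_row k A B X /\ interlacing X].

(* Meaningful for finite S only: [fset_set] sends an infinite set to fset0. *)
Definition uniform_probability (R : realType) (T : choiceType)
    (S E : set T) : R :=
  #|` fset_set (S `&` E)|%fset%:R / #|` fset_set S|%fset%:R.

Definition particle_at (N : nat) (X : array N) (x : int) (n : nat) : Prop :=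
  exists2 p : site N, row_of p = n & X p = x.

Definition correlation (R : realType) (k N : nat) (A B : nat -> rat)
    (s : nat) (x : 'I_s -> int) (n : 'I_s -> nat) : R :=
  uniform_probability R (@arrays k N A B)
    [set X | forall i : 'I_s, particle_at X (x i) (n i)].

(* Main.v *)
Require Import Defs.
From HB Require Import structures.
From mathcomp Require Import all_boot all_order all_algebra.
From mathcomp Require Import fingroup perm finmap.
From mathcomp Require Import all_classical all_reals all_analysis.
From mathcomp Require Import complex.
From mathcomp Require Import measurable_realfun ring lra zify.
Set Implicit Arguments.
Unset Strict Implicit.
Unset Printing Implicit Defensive.
Import Order.TTheory GRing.Theory Num.Theory.
Import numFieldNormedType.Exports.
Local Open Scope classical_set_scope.
Local Open Scope ring_scope.
Local Open Scope complex_scope.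

(** Summing over the positions of one row at a time, multilinearity of the
determinant turns the number of arrays, with a weight d m x for each particle
at (x, m), into det[psi_N i (top_j)], where psi_(m+1) i is a discrete
antiderivative of d_m psi_m i.  For d = 1 one may take Pochhammer polynomials.
Multiplying d by 1 + h at s sites perturbs the matrix by rank s, so that the
weighted count is the number of arrays times an s x s determinant det(1 + h K),
and the coefficients of h^s yield the correlation function.  Here K involves
the coefficients that express the polynomials at level n through those at the
top level; Lagrange interpolation at the top row P(w) = prod (w - a) gives them
as (N - n)! q(a) / P'(a), with q the quotient of P by
prod_(l <= N - n) (w - x + l).  The double contour integral produces the same
numbers: the residues in w add up to q(z), and those in z are taken at the
points a >= x2 of the top row. *)

(** Why weights 1 + h: they keep the count inside the determinantal scheme for every h. Each site
    becomes a point source for the discrete antiderivatives, with strength h times the value of the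
    function at the site, and the source spreads to higher levels by [chain_fun]. This is where the
    rank s comes from. The factor (N - n)! arises because descending N - n levels is an iterated
    backward difference, which on unit-spaced nodes is (N - n)! times a divided difference, that is,
    times the leading coefficient of a remainder modulo the node polynomial. The contours are
    arbitrary piecewise C1 curves known only through winding numbers, and no Cauchy theorem is used.
    All integrands are rational with simple poles: polynomials have primitives and integrate to 0
    over a closed curve, while 1/(z - a) yields the winding number by definition. *)

(** * Discrete antiderivatives and their Green function *)

Section Pochhammer.
Variable F : numFieldType.
Implicit Types (k : nat).

Lemma pochhammerS (x : F) k : pochhammer x k.+1 = pochhammer x k * (x + k%:R).
Proof. by rewrite /pochhammer big_ord_recr. Qed.

Lemma pochhammerSl (x : F) k : pochhammer (x - 1) k.+1 = (x - 1) * pochhammer x k.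
Proof.
rewrite /pochhammer big_ord_recl /= addr0; congr (_ * _); apply: eq_bigr => i _.
by rewrite /bump /= add1n -natr1; ring.
Qed.

(** The binomial coefficient binom(x + k - 1, k). Its backward difference lowers k by one
    ([rbin_diff]), which is Pascal's rule. *)
Definition rbin (x : F) k : F := pochhammer x k / k`!%:R.

Lemma rbin0 x : rbin x 0 = 1.
Proof. by rewrite /rbin /pochhammer big_ord0 fact0 divr1. Qed.

Lemma fact_neq0 k : k`!%:R != 0 :> F.
Proof. by rewrite pnatr_eq0 -lt0n fact_gt0. Qed.

Lemma rbin_diff x k : rbin x k.+1 - rbin (x - 1) k.+1 = rbin x k.
Proof.
rewrite /rbin pochhammerS pochhammerSl factS natrM -mulrBl.
have kn0 : k.+1%:R != 0 :> F by rewrite pnatr_eq0.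
have fn0 := fact_neq0 k.
by rewrite -natr1 in kn0 *; field; rewrite fn0 kn0.
Qed.

Lemma rbin_0S k : rbin 0 k.+1 = 0.
Proof. by rewrite /rbin /pochhammer big_ord_recl /= addr0 !mul0r. Qed.

(** For i < m these are polynomials of degree m - 1 - i, the family of antiderivatives for weight 1.
    The value 0 for i >= m makes the difference rule hold for all i and m: at i = m it says that the
    constant 1 has difference 0. *)
Definition base_fun (i m : nat) (x : int) : F :=
  if (i < m)%N then rbin x%:~R (m - i.+1) else 0.

Lemma base_fun_diff i m x :
  base_fun i m.+1 x - base_fun i m.+1 (x - 1) = base_fun i m x.
Proof.
rewrite /base_fun ltnS; case: (ltngtP i m) => [im|im|->].
- by rewrite subSn // rmorphB /= rbin_diff.
- by rewrite subr0.
- by rewrite subnn !rbin0 subrr.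
Qed.

Lemma base_fun_top m x : base_fun m m.+1 x = 1.
Proof. by rewrite /base_fun ltnSn subnn rbin0. Qed.

(* The number of ways to go from u at level m to x at level n with weakly
increasing steps at the intermediate levels. *)
Definition chain_fun (u : int) (m : nat) (x : int) (n : nat) : F :=
  if (m < n)%N && (u <= x) then rbin (x - u + 1)%:~R (n - m.+1) else 0.

(** [chain_fun] is the Green function of the backward difference with source at (u, m). Above level
    m + 1 the cutoff at u does no harm, since [rbin] of positive degree vanishes at 0; at level m +
    1 it is a step function, whose jump is the source term. With (u, m) = (x2, n2) and (x, n) = (x1,
    n1) it is minus the first summand of K. *)
Lemma chain_fun_diff u m x n :
  chain_fun u m x n.+1 - chain_fun u m (x - 1) n.+1 =
  chain_fun u m x n + ((u == x) && (m == n))%:R.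
Proof.
rewrite /chain_fun ltnS; case: (ltngtP m n) => [mn|mn|->] /=.
- rewrite andbF addr0 subSn //.
  have [ux|ux|<-] := ltgtP u x.
  + rewrite ifT; last by lia.
    rewrite -[RHS]rbin_diff; congr (_ - rbin _ _).
    by rewrite -[1 in RHS](mulr1z 1) -rmorphB; congr (_%:~R); lia.
  + by rewrite ifF ?subr0 //; lia.
  + rewrite ifF ?subr0; last by lia.
    by rewrite -[RHS]rbin_diff subrr !add0r subrr rbin_0S subr0.
- by rewrite andbF subr0 addr0.
- rewrite subnn !rbin0 andbT add0r.
  have [ux|ux|<-] := ltgtP u x.
  + by rewrite ifT ?subrr //; lia.
  + by rewrite ifF ?subr0 //; lia.
  + by rewrite ifF ?subr0 //; lia.
Qed.

End Pochhammer.

(** * Interlacing rows as products of integer intervals *)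

Definition intv (a b : int) : seq int :=
  if a <= b then [seq a + k.+1%:Z | k <- iota 0 `|b - a|%N] else [::].

Lemma mem_intv (a b x : int) : (x \in intv a b) = (a < x <= b).
Proof.
rewrite /intv; case: ifP => ab; last by rewrite in_nil; lia.
apply/mapP/idP => [[k]|h]; first by rewrite mem_iota; lia.
by exists (absz (x - a - 1)%R); rewrite ?mem_iota; lia.
Qed.

Lemma uniq_intv a b : uniq (intv a b).
Proof.
rewrite /intv; case: ifP => // _; rewrite map_inj_uniq ?iota_uniq // => i j; lia.
Qed.

Lemma sum_intv (V : zmodType) (f G : int -> V) a b : a <= b ->
  (forall z, G z - G (z - 1) = f z) -> \sum_(z <- intv a b) f z = G b - G a.
Proof.
move=> ab hG; rewrite /intv ab big_map -[X in iota 0 X]subn0 -/(index_iota 0 _).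
have -> : b = a + `|b - a|%N by lia.
move: (`|b - a|%N) => n; have -> : absz (a + n%:Z - a)%R = n by lia.
elim: n => [|n IH]; first by rewrite big_geq // addr0 subrr.
rewrite big_nat_recr //= IH -hG.
by have -> : a + n.+1%:Z - 1 = a + n by [lia]; rewrite addrC subrKA.
Qed.

Lemma gt_int_trans : transitive (>%R : rel int).
Proof. by move=> ? ? ? h1 h2; exact: lt_trans h2 h1. Qed.

Lemma gt_sorted_uniq (s : seq int) : sorted >%R s -> uniq s.
Proof. by apply: (@sorted_uniq _ (>%R : rel int) gt_int_trans) => v; exact: ltxx. Qed.

(** The j-th entry ranges over ]y_(j+1), y_j] whatever the other entries are. The rows below a given
    one thus form a product, so that sums over them factor, and half-open intervals make each factor
    telescope. *)
Fixpoint box (a : int) (s : seq int) : seq (seq int) :=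
  if s is b :: s' then [seq z :: r | z <- intv b a, r <- box b s']
  else [:: [::]].

Definition interlace (y z : seq int) : bool :=
  (size y == (size z).+1) &&
  all (fun j => nth 0 y j.+1 < nth 0 z j <= nth 0 y j) (iota 0 (size z)).

Lemma interlaceP y z :
  reflect (size y = (size z).+1 /\
    forall j, (j < size z)%N -> nth 0 y j.+1 < nth 0 z j <= nth 0 y j)
  (interlace y z).
Proof.
apply: (iffP andP) => [[/eqP h1 /allP h2]|[h1 h2]]; split=> //.
- by move=> j hj; apply: h2; rewrite mem_iota.
- by apply/eqP.
- by apply/allP => j; rewrite mem_iota => hj; apply: h2.
Qed.

Lemma interlace_cons a b s z r :
  interlace [:: a, b & s] (z :: r) = (b < z <= a) && interlace (b :: s) r.
Proof.
apply/interlaceP/andP => [[/= [h1] h2]|[h0 /interlaceP[h1 h2]]].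
  split; first exact: (h2 0%N).
  by apply/interlaceP; split=> [|j hj]; [rewrite /= h1 | exact: (h2 j.+1)].
by split=> [|[|j] hj] //; [case: h1 => /= -> | exact: h2].
Qed.

Lemma mem_box a s r : (r \in box a s) = interlace (a :: s) r.
Proof.
elim: s a r => [|b s IH] a r /=.
  rewrite inE; case: r => [|? ?] //=.
apply/allpairsPdep/idP => [[z [r' [hz hr ->]]]|].
  by rewrite interlace_cons -IH hr andbT -mem_intv.
case: r => [|z r]; first by case/interlaceP.
rewrite interlace_cons => /andP[hz hr].
by exists z, r; rewrite mem_intv IH.
Qed.

Lemma uniq_box a s : uniq (box a s).
Proof.
elim: s a => [|b s IH] a //=; apply: allpairs_uniq => //.
- exact: uniq_intv.
- by move=> [? ?] [? ?] /= _ _ [-> ->].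
Qed.

Lemma size_box a s r : r \in box a s -> size r = size s.
Proof. by rewrite mem_box => /interlaceP[/= []]. Qed.

Lemma sum_box_prod (F : comPzRingType) (g : nat -> int -> F) a s :
  \sum_(r <- box a s) \prod_(j < size s) g j (nth 0 r j) =
  \prod_(j < size s) \sum_(z <- intv (nth 0 s j) (nth 0 (a :: s) j)) g j z.
Proof.
elim: s a g => [|b s IH] a g /=; first by rewrite big_seq1 !big_ord0.
rewrite big_allpairs_dep big_ord_recl /= big_distrl /=; apply: eq_bigr => z _.
rewrite -(IH b (fun j => g j.+1)) big_distrr /=; apply: eq_bigr => r _.
by rewrite big_ord_recl.
Qed.

Definition boxes (y : seq int) : seq (seq int) :=
  if y is a :: s then box a s else [::].

Lemma mem_boxes y r : (r \in boxes y) = interlace y r.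
Proof. by case: y => [|a s] /=; [case: r | exact: mem_box]. Qed.

(** Neighbouring intervals share an end point: z_(j+1) <= y_(j+1) < z_j. *)
Lemma sorted_interlace y z : interlace y z -> sorted >%R z.
Proof.
case/interlaceP => _ h; apply/(sortedP 0) => j hj.
have /andP[h1 _] := h j (ltnW hj); have /andP[_ h2] := h _ hj.
exact: le_lt_trans h2 h1.
Qed.

(* The interlacing rows below a top row [y] of size m.+1, listed downwards from
level m to level 1. *)
Fixpoint schemes (m : nat) (y : seq int) : seq (seq (seq int)) :=
  if m is m'.+1 then [seq z :: r | z <- boxes y, r <- schemes m' z]
  else [:: [::]].

Lemma mem_schemes m y r :
  (r \in schemes m y) = (size r == m) && path interlace y r.
Proof.
elim: m y r => [|m IH] y r /=; first by rewrite inE; case: r.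
apply/allpairsPdep/andP => [[z [r' [hz hr ->]]]|].
  by move: hr; rewrite IH => /andP[/eqP <- hr] /=; rewrite eqxx hr -mem_boxes hz.
case: r => [|z r] [] //= hs /andP[h1 h2].
by exists z, r; rewrite mem_boxes IH h2 h1 andbT; split.
Qed.

Lemma uniq_schemes m y : uniq (schemes m y).
Proof.
elim: m y => [|m IH] y //=; apply: allpairs_uniq_dep => //.
- by case: y => //= a s; exact: uniq_box.
- by move=> [? ?] [? ?] /= _ _ [-> ->].
Qed.

(** * Weighted counts as determinants *)

Section Count.
Variable F : numFieldType.

(* Subtract from each column the next one and expand along the last row. *)
Lemma det_ones_last n (A : 'M[F]_n.+1) : (forall j, A ord_max j = 1) ->
  \det A = \det (\matrix_(i < n, j < n)
    (A (lift ord_max i) (lift ord_max j) - A (lift ord_max i) (lift ord0 j))).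
Proof.
move=> h1.
pose U : 'M[F]_n.+1 :=
  \matrix_(i, j) ((i == j)%:R - (nat_of_ord i == j.+1)%:R).
have detU : \det U = 1.
  rewrite det_trig.
    rewrite big1 // => i _; rewrite !mxE eqxx; case: eqP; [lia | by rewrite subr0].
  apply/is_trig_mxP => i j ij; rewrite !mxE.
  case: eqP => [e|_]; first by move: ij; rewrite e; lia.
  by case: eqP; [lia | rewrite subr0].
have AU i j : (A *m U) i j = A i j -
    (if unlift ord_max j is Some j' then A i (lift ord0 j') else 0).
  rewrite !mxE; under eq_bigr do rewrite !mxE mulrBr.
  rewrite sumrB (bigD1 j) //= eqxx mulr1 big1 ?addr0; last first.
    by move=> k /negbTE ->; rewrite mulr0.
  congr (_ - _); case: unliftP => [j' ->|->].
    have jn : (j' < n)%N := ltn_ord j'.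
    rewrite (bigD1 (lift ord0 j')) //=.
    rewrite big1 ?addr0; last first.
      move=> k hk; case: eqP; rewrite ?mulr0 // => e.
      case/eqP: hk; by apply: val_inj; rewrite /= e /= /bump leqNgt jn.
    by rewrite /bump leq0n [(n <= j')%N]leqNgt jn eqxx mulr1.
  rewrite big1 // => k _; case: eqP; rewrite ?mulr0 // => /= e.
  by have := ltn_ord k; rewrite e ltnn.
rewrite -[LHS]mulr1 -detU -det_mulmx (expand_det_row _ ord_max).
rewrite (bigD1 ord_max) //= AU unlift_none subr0 h1 mul1r big1 ?addr0; last first.
  move=> j; case: (unliftP ord_max j) => [j' -> _|->]; last by rewrite eqxx.
  by rewrite AU liftK !h1 subrr mul0r.
rewrite /cofactor addnn -signr_odd odd_double mul1r; congr (\det _).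
by apply/matrixP => i j; rewrite 2![LHS]mxE AU liftK [RHS]mxE.
Qed.

Variable d : nat -> int -> F.

(** Here m is the level of the head of the list. The top row is not in the list and carries no
    weight. *)
Fixpoint weight (m : nat) (r : seq (seq int)) : F :=
  if r is z :: r' then (\prod_(x <- z) d m x) * weight m.-1 r' else 1.

Variable psi : nat -> nat -> int -> F.
Hypothesis psi_diff : forall m i x, (i < m)%N ->
  psi m.+1 i x - psi m.+1 i (x - 1) = d m x * psi m i x.
Hypothesis psi_top : forall m x, psi m.+1 m x = 1.

(* Given [y], the entries of the next row range over independent intervals, so
the sum over that row can be moved inside the columns of the determinant. *)
Lemma sum_weight m y : size y = m.+1 -> sorted >%R y ->
  \sum_(r <- schemes m y) weight m r =
  \det (\matrix_(i < m.+1, j < m.+1) psi m.+1 i (nth 0 y j)).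
Proof.
elim: m y => [|m IH] y sy srt.
  by rewrite big_seq1 det_mx11 mxE psi_top.
rewrite [schemes _ _]/= big_allpairs_dep /=.
under eq_bigr do rewrite -big_distrr /=.
case: y sy srt => [//|a s] [ss] srt; rewrite [boxes _]/=.
(* The permutation is extended to all naturals, as [sum_box_prod] takes functions of a natural
   index; the weight of an entry is absorbed into its column. *)
pose g (p : 'S_m.+1) j z :=
  d m.+1 z * psi m.+1 (odflt ord0 (omap p (insub j))) z.
transitivity (\sum_(z <- box a s) \sum_(p : 'S_m.+1)
    (-1) ^+ p * \prod_(j < size s) g p j (nth 0 z j)).
  apply: eq_big_seq => z hz; have sz := size_box hz.
  rewrite IH; [|by rewrite sz|by apply: (@sorted_interlace (a :: s)); rewrite -mem_box].
  (* After transposition the Leibniz product runs over the entries of the row [z]. *)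
  rewrite -det_tr big_distrr /=; apply: eq_bigr => p _.
  rewrite mulrCA; congr (_ * _).
  rewrite (big_nth 0) sz ss big_mkord -big_split /=; apply: eq_bigr => j _.
  rewrite !mxE /g insubT //= => ?; congr (_ * psi _ _ _).
  by congr (nat_of_ord (p _)); apply: val_inj.
(* The last function is the constant 1, so the right-hand side reduces to a determinant of
   differences psi(y_j) - psi(y_(j+1)), which are the interval sums of the left-hand side. *)
rewrite exchange_big /= det_ones_last; last first.
  by move=> j; rewrite mxE psi_top.
rewrite -det_tr; apply: eq_bigr => p _.
rewrite -big_distrr /= sum_box_prod ss; congr (_ * _); apply: eq_bigr => j _.
rewrite !mxE /g insubT //= => hj; rewrite (_ : Sub _ _ = j); last exact: val_inj.
have -> : bump m.+1 (p j) = p j by rewrite /bump leqNgt ltn_ord.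
have -> : bump m.+1 j = j by rewrite /bump leqNgt ltn_ord.
rewrite (sum_intv (G := psi m.+2 (p j))) //; last first.
  by move=> z; apply: psi_diff.
by apply: ltW; move/(sortedP 0)/(_ j): srt; rewrite /= ss ltnS ltn_ord => ->.
Qed.

End Count.

(** * Point perturbations of the weight and correlations *)

Section Determinantal.
Variable F : numFieldType.
Variables (s m : nat) (x : 'I_s -> int) (n : 'I_s -> nat) (y : seq int).
Hypothesis size_y : size y = m.+1.
Hypothesis sorted_y : sorted >%R y.
Hypothesis nP : forall j, (1 <= n j <= m)%N.
Hypothesis distinct : forall i j, i != j -> (x i, n i) != (x j, n j).
Variable c : 'M[F]_(m.+1, s).
Hypothesis c_interp : forall (i : 'I_m.+1) j,
  base_fun F i (n j) (x j) = \sum_(a < m.+1) base_fun F i m.+1 (nth 0 y a) * c a j.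

Definition chain_mx : 'M[F]_s :=
  \matrix_(j, l) chain_fun F (x j) (n j) (x l) (n l).
Definition chain_top_mx : 'M[F]_(s, m.+1) :=
  \matrix_(j, a) chain_fun F (x j) (n j) (nth 0 y a) m.+1.
Definition base_top_mx : 'M[F]_m.+1 :=
  \matrix_(i, a) base_fun F i m.+1 (nth 0 y a).
Definition base_mx : 'M[F]_(m.+1, s) :=
  \matrix_(i, j) base_fun F i (n j) (x j).
Definition kernel_mx : 'M[F]_s := chain_top_mx *m c - chain_mx.

(* [chain_mx] is strictly triangular with respect to the levels [n], and a
permutation other than the identity moves some index without raising its level. *)
Lemma det_sub_chain_mx (h : F) : \det (1%:M - h *: chain_mx) = 1.
Proof.
rewrite /determinant (bigD1 (1%g : 'S_s)) //= odd_perm1 mul1r.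
rewrite [X in X + _]big1 ?[X in _ + X]big1 ?addr0 // => [p p1|i _]; last first.
  by rewrite perm1 !mxE eqxx /chain_fun ltnn mulr0 subr0.
(* If every moved index went to a strictly higher level, the sum of all levels would grow under [p],
   whereas reindexing leaves it unchanged. *)
have [i hi] : exists i, (n (p i) <= n i)%N && (p i != i).
  apply/existsP; apply: contraNT p1; rewrite negb_exists => /forallP hp.
  have le i : (n i <= n (p i) ?= iff (p i == i))%N.
    split; have := hp i; first by case: eqP => [->|_] //; rewrite andbT; lia.
    case: eqP => [->|_]; [by rewrite eqxx | rewrite andbT; lia].
  have [_] := leqif_sum (fun i (_ : true) => le i).
  rewrite [X in X == _](reindex_inj (@perm_inj _ p)) eqxx => /esym/forallP hall.
  apply/eqP/permP => i; rewrite perm1.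
  exact/eqP/hall.
rewrite (bigD1 i) //= !mxE /chain_fun; case/andP: hi => h1 /negbTE h2.
by rewrite eq_sym h2 ltnNge h1 /= mulr0 subr0 mul0r mulr0.
Qed.

Section Perturbed.
Variable h : F.

(** The source strengths must equal the values at the sites of the very function that they perturb.
    This self-consistency is the linear system a (1 - h [chain_mx]) = base values, solved here and
    read back in [amplitudeE]. *)
Definition amplitude (i : nat) : 'rV[F]_s :=
  (\row_j base_fun F i (n j) (x j)) *m invmx (1%:M - h *: chain_mx).

Definition site_weight (k : nat) (u : int) : F :=
  \prod_j (if (x j, n j) == (u, k) then 1 + h else 1).

Definition perturbed_fun (k i : nat) (u : int) : F :=
  base_fun F i k u + \sum_j h * amplitude i 0 j * chain_fun F (x j) (n j) u k.

Lemma amplitudeE i j : amplitude i 0 j = perturbed_fun (n j) i (x j).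
Proof.
have := congr1 (fun A : 'rV_s => A 0 j)
  (mulmxKV (_ : 1%:M - h *: chain_mx \in unitmx) (\row_j base_fun F i (n j) (x j))).
rewrite unitmxE det_sub_chain_mx unitr1 => /(_ isT).
rewrite mulmxBr mulmx1 !mxE => /eqP; rewrite subr_eq => /eqP ->.
by congr (_ + _); apply: eq_bigr => l _; rewrite !mxE mulrA (mulrC h).
Qed.

(** Induction on the level: an amplitude involves only amplitudes at strictly lower levels, and
    [base_fun i] vanishes at levels up to i. Hence the function of index k receives no correction at
    level k + 1 and remains the constant 1 there, as [sum_weight] requires. *)
Lemma amplitude_eq0 i j : (n j <= i)%N -> amplitude i 0 j = 0.
Proof.
have [k] := ubnP (n j); elim: k j => // k IH j hk hi.
rewrite amplitudeE /perturbed_fun /base_fun ltnNge hi add0r big1 // => l _.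
rewrite /chain_fun; case: ltnP => //= hl; last by rewrite mulr0.
by rewrite IH ?mulr0 ?mul0r //; lia.
Qed.

Lemma perturbed_fun_top k u : perturbed_fun k.+1 k u = 1.
Proof.
rewrite /perturbed_fun base_fun_top big1 ?addr0 // => j _.
have [hj|hj] := leqP (n j) k; first by rewrite amplitude_eq0 // mulr0 mul0r.
by rewrite /chain_fun ltnNge hj mulr0.
Qed.

(** A site at (u, k) adds h times its amplitude to the difference, which by [amplitudeE] is h times
    the perturbed function itself: this is the factor 1 + h. As the sites are distinct, at most one
    contributes. *)
Lemma perturbed_fun_diff k i u :
  perturbed_fun k.+1 i u - perturbed_fun k.+1 i (u - 1) =
  site_weight k u * perturbed_fun k i u.
Proof.
transitivity (perturbed_fun k i u +
    \sum_j h * amplitude i 0 j * ((x j, n j) == (u, k))%:R).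
  rewrite /perturbed_fun opprD addrACA base_fun_diff -addrA; congr (_ + _).
  rewrite -sumrB -big_split /=; apply: eq_bigr => j _.
  by rewrite -mulrBr chain_fun_diff mulrDr xpair_eqE.
rewrite /site_weight; case: (pickP (fun j => (x j, n j) == (u, k))) => [j hj|h0].
  have hne l : l != j -> ((x l, n l) == (u, k)) = false.
    by move=> /distinct; rewrite (eqP hj) => /negbTE.
  rewrite (bigD1 j) //= big1 => [|l /hne ->]; last by rewrite mulr0.
  rewrite [in RHS](bigD1 j) //= big1 => [|l /hne -> //].
  rewrite hj /=; case/eqP: hj => <- <-; rewrite -amplitudeE; ring.
rewrite [in RHS]big1 => [|j _]; last by rewrite h0.
by rewrite big1 => [|j _]; rewrite ?h0 ?mulr0 // addr0 mul1r.
Qed.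

(* Both sides are evaluations of the determinant of the block matrix [D]:
eliminating [base_mx] with [B] leaves the perturbed functions at the top level,
eliminating it with [c] leaves the small determinant. *)
Lemma sum_site_weight :
  \sum_(r <- schemes m y) weight site_weight m r =
  \det base_top_mx * \det (1%:M + h *: kernel_mx).
Proof.
rewrite (sum_weight (psi := perturbed_fun)) //; last first.
- exact: perturbed_fun_top.
- by move=> *; apply: perturbed_fun_diff.
pose B := base_mx *m invmx (1%:M - h *: chain_mx).
have BE (i : 'I_m.+1) j : B i j = amplitude i 0 j.
  by rewrite !mxE; apply: eq_bigr => l _; rewrite !mxE.
pose D := block_mx base_top_mx base_mx
  (- (h *: chain_top_mx)) (1%:M - h *: chain_mx).
have -> : (\matrix_(i < m.+1, j < m.+1) perturbed_fun m.+1 i (nth 0 y j)) =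
    base_top_mx + B *m (h *: chain_top_mx).
  apply/matrixP => i j; rewrite mxE [RHS]mxE [base_top_mx _ _]mxE [X in _ = _ + X]mxE.
  congr (_ + _); apply: eq_bigr => l _.
  by rewrite BE [X in _ = _ * X]mxE [chain_top_mx _ _]mxE mulrA (mulrC h).
have e1 : \det D = \det (base_top_mx + B *m (h *: chain_top_mx)).
  transitivity (\det (block_mx 1%:M (- B) 0 1%:M *m D)).
    by rewrite det_mulmx det_ublock !det1 !mul1r.
  rewrite mulmx_block !mul0mx !mul1mx !add0r.
  rewrite !mulNmx mulmxN opprK.
  rewrite mulmxKV ?unitmxE ?det_sub_chain_mx ?unitr1 // subrr.
  by rewrite det_lblock det_sub_chain_mx mulr1.
rewrite -e1; transitivity (\det (D *m block_mx 1%:M (- c) 0 1%:M)).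
  by rewrite det_mulmx det_ublock !det1 !mulr1.
rewrite mulmx_block !mulmx0 !mulmx1 !addr0.
have -> : base_top_mx *m (- c) + base_mx = 0.
  apply/matrixP => i j; rewrite mulmxN !mxE c_interp addrC.
  by apply/eqP; rewrite subr_eq0; apply/eqP/eq_bigr => a _; rewrite !mxE.
rewrite det_lblock; congr (_ * \det _).
rewrite mulNmx mulmxN opprK -scalemxAl /kernel_mx scalerBr.
by rewrite addrCA.
Qed.

Lemma weight_prod k r :
  weight site_weight k r =
  \prod_j weight (fun k' u => if (x j, n j) == (u, k') then 1 + h else 1) k r.
Proof.
elim: r k => [|z r IH] k /=; first by rewrite big1.
by rewrite IH big_split /= exchange_big.
Qed.

(** A row is strictly decreasing, so it contains u at most once and the factor 1 + h is not
    repeated. Rows are listed downwards from level k', which puts level k at index k' - k. *)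
Lemma weight_point k u z k' r : r \in schemes k' z -> (0 < k)%N ->
  weight (fun k' u' => if (u, k) == (u', k') then 1 + h else 1) k' r =
  if (k <= k')%N && (u \in nth [::] r (k' - k)) then 1 + h else 1.
Proof.
move=> + k0; elim: k' z r => [|k' IH] z r /=.
  by rewrite inE leqNgt k0 => /eqP ->.
case/allpairsPdep => z' [r' [hz hr ->]] /=; rewrite (IH _ _ hr).
have uz : uniq z' by apply/gt_sorted_uniq/(@sorted_interlace z); rewrite -mem_boxes.
have [kk|kk|->] := ltngtP k k'.+1.
- rewrite ltnS in kk; rewrite big1 ?mul1r ?subSn ?kk ?leqW //.
  by move=> v _; rewrite xpair_eqE ltn_eqF ?andbF.
- rewrite big1 ?mul1r ?[(k <= k')%N]leqNgt ?(ltnW kk) // => v _.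
  by rewrite xpair_eqE gtn_eqF ?andbF.
- rewrite ltnn mulr1 subnn /=; case: ifP => hu.
    rewrite (big_rem u) //= eqxx big_seq big1 ?mulr1 // => v.
    by rewrite mem_rem_uniq // !inE xpair_eqE eq_sym => /andP[/negbTE ->].
  rewrite big_seq big1 // => v hv; rewrite xpair_eqE.
  by case: eqP => // e; rewrite e hv in hu.
Qed.

End Perturbed.

Definition occupied (j : 'I_s) (r : seq (seq int)) : bool :=
  x j \in nth [::] r (m - n j).

Lemma sum_occupied (h : F) :
  \sum_(r <- schemes m y) \prod_j (1 + h * (occupied j r)%:R) =
  \det base_top_mx * \det (1%:M + h *: kernel_mx).
Proof.
rewrite -sum_site_weight; apply: eq_big_seq => r hr; rewrite weight_prod.
apply: eq_bigr => j _; have /andP[n1 n2] := nP j.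
rewrite (weight_point _ _ hr) // n2 /occupied /=.
by case: ifP => _; rewrite ?mulr1 ?mulr0 ?addr0.
Qed.

Lemma size_schemes_det : (size (schemes m y))%:R = \det base_top_mx.
Proof.
have := sum_occupied 0; rewrite scale0r addr0 det1 mulr1 => <-.
rewrite -sum1_size natr_sum; apply: eq_bigr => r _.
by rewrite big1 // => j _; rewrite mul0r addr0.
Qed.

Lemma horner_eq_off0 (p q : {poly F}) :
  (forall u, u != 0 -> p.[u] = q.[u]) -> p = q.
Proof.
move=> pq; apply/eqP; rewrite -subr_eq0; apply: contraT => e0.
have := max_poly_roots (rs := [seq k.+1%:R | k <- iota 0 (size (p - q))]) e0.
rewrite size_map size_iota ltnn => -> //.
  apply/allP => _ /mapP[k _ ->]; by rewrite rootE hornerD hornerN pq ?subrr ?pnatr_eq0.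
rewrite map_inj_uniq ?iota_uniq // => i j /eqP.
by rewrite eqr_nat => /eqP[].
Qed.

Lemma horner_char_poly k (A : 'M[F]_k) u :
  (char_poly A).[u] = \det (u%:M - A).
Proof.
rewrite /char_poly -horner_evalE -det_map_mx; congr (\det _).
apply/matrixP => i j; rewrite !mxE /= /horner_eval hornerD hornerN hornerC.
by rewrite hornerMn hornerX.
Qed.

(* Compares, at u = 1/h = 0, two polynomials in u that agree for u != 0. *)
Lemma count_occupied :
  (count (fun r => [forall j, occupied j r]) (schemes m y))%:R =
  (size (schemes m y))%:R * \det kernel_mx.
Proof.
(* For u != 0 this is u^s times the left side of [sum_occupied] at h = 1/u. At u = 0 only the
   schemes occupied at all sites survive, while u^s det(1 + K/u) = det(u + K) becomes det K. *)
pose p := \sum_(r <- schemes m y) \prod_j ('X + ((occupied j r)%:R : F)%:P).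
have e : p = (size (schemes m y))%:R *: char_poly (- kernel_mx).
  apply: horner_eq_off0 => u u0; rewrite hornerZ horner_char_poly opprK.
  have -> : u%:M + kernel_mx = u *: (1%:M + u^-1 *: kernel_mx).
    by rewrite scalerDr scalerA mulfV // scale1r scale_scalar_mx mulr1.
  rewrite detZ mulrCA size_schemes_det -sum_occupied mulr_sumr horner_sum.
  apply: eq_bigr => r _; rewrite horner_prod -[X in u ^+ X]card_ord -prodr_const.
  rewrite -big_split /=; apply: eq_bigr => j _.
  by rewrite !hornerE mulrDr mulrA mulfV // mulr1 mul1r.
have := congr1 (fun p => p.[0]) e.
rewrite hornerZ horner_char_poly raddf0 sub0r opprK => <-.
rewrite -sum1_count natr_sum big_mkcond horner_sum; apply: eq_bigr => r _.
rewrite horner_prod; under eq_bigr do rewrite !hornerE.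
case: forallP => [hr|/forallP]; first by rewrite big1 // => j _; rewrite hr.
by rewrite negb_forall => /existsP[j /negbTE hj]; rewrite (bigD1 j) //= hj mul0r.
Qed.

End Determinantal.

(** * Lagrange interpolation and divided differences *)

Section Interpolation.
Variable F : fieldType.
Implicit Types (f : {poly F}) (t : seq F).

(** For duplicate-free t containing a and P = prod (X - b), this is P / (X - a), and its value at a
    is P'(a). *)
Definition root_cofactor t (a : F) : {poly F} := \prod_(b <- t | b != a) ('X - b%:P).

Lemma prod_root_cofactor t a : uniq t -> a \in t ->
  \prod_(b <- t) ('X - b%:P) = ('X - a%:P) * root_cofactor t a.
Proof. by move=> ut at_; rewrite (bigD1_seq a). Qed.

Lemma root_cofactor_neq0 t a : (root_cofactor t a).[a] != 0.
Proof.
rewrite horner_prod prodf_seq_neq0; apply/allP => b _; apply/implyP => ba.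
by rewrite hornerXsubC subr_eq0 eq_sym.
Qed.

Lemma root_cofactor_eq0 t a b : b \in t -> b != a -> (root_cofactor t a).[b] = 0.
Proof.
move=> bt ba; apply/rootP; rewrite /root_cofactor -big_filter root_prod_XsubC.
by rewrite mem_filter ba.
Qed.

Lemma size_root_cofactor t a : uniq t -> a \in t -> size (root_cofactor t a) = size t.
Proof.
move=> ut at_; rewrite /root_cofactor -big_filter size_prod_XsubC size_filter.
rewrite -(count_predC (pred1 a) t) (count_uniq_mem _ ut) at_ add1n.
by congr _.+1.
Qed.

Lemma root_cofactor_monic t a : root_cofactor t a \is monic.
Proof. exact: monic_prod_XsubC. Qed.

(** Lagrange's formula: the difference of the two sides has degree less than [size t] and vanishes
    on [t]. *)
Lemma interpolation t f : uniq t -> (size f <= size t)%N ->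
  f = \sum_(a <- t) (f.[a] / (root_cofactor t a).[a]) *: root_cofactor t a.
Proof.
move=> ut sf; apply/eqP; rewrite -subr_eq0; apply/eqP.
apply: (@roots_geq_poly_eq0 _ _ t) => //.
  apply/allP => b bt; rewrite rootE hornerD hornerN horner_sum (bigD1_seq b) //=.
  rewrite hornerZ divfK ?root_cofactor_neq0 // big_seq_cond big1 ?addr0 ?subrr //.
  by move=> a /andP[_ ab]; rewrite hornerZ (@root_cofactor_eq0 _ a b) ?mulr0 // eq_sym.
rewrite (leq_trans (size_polyD _ _)) // size_polyN geq_max sf big_seq.
apply: (leq_trans (size_sum _ _ _)); apply/bigmax_leqP_seq => a at_ _.
by rewrite (leq_trans (size_scale_leq _ _)) // size_root_cofactor.
Qed.

(** The cofactors are monic of degree [size t - 1], so the top coefficient adds up the Lagrange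
    weights. The right-hand side is the sum of the residues of f / prod (X - a). *)
Lemma coef_interpolation t f : uniq t -> (size f <= size t)%N ->
  f`_(size t).-1 = \sum_(a <- t) f.[a] / (root_cofactor t a).[a].
Proof.
move=> ut sf; rewrite [in LHS](interpolation ut sf) coef_sum.
apply: eq_big_seq => a at_; rewrite coefZ -(size_root_cofactor ut at_).
by rewrite -lead_coefE (monicP (root_cofactor_monic _ _)) mulr1.
Qed.

(* If [L %% Q] has leading term k X^r, then k Q is the polynomial part added by
the factor X - a, and the other part of the quotient vanishes at a. *)
Lemma divp_horner_root (L Q : {poly F}) a r : Q \is monic -> size Q = r.+2 ->
  ((('X - a%:P) * L) %/ Q).[a] = (L %% Q)`_r.
Proof.
move=> mQ sQ; set k := (L %% Q)`_r.
have Q0 : Q != 0 by rewrite monic_neq0.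
have e : ('X - a%:P) * L =
    (('X - a%:P) * (L %/ Q) + k%:P) * Q + (('X - a%:P) * (L %% Q) - k *: Q).
  by rewrite {1}(divp_eq L Q) -mul_polyC; ring.
rewrite -(divpP e); first by rewrite hornerD hornerM hornerXsubC subrr mul0r hornerC add0r.
rewrite sQ ltnS; apply/leq_sizeP => j hj.
rewrite coefB mulrBl coefB mulrC coefMX coefCM coefZ.
have sm : (size (L %% Q)%R <= r.+1)%N by rewrite -ltnS -sQ ltn_modp.
case: j hj => // j hj; rewrite /= (nth_default 0 (leq_trans sm hj)) mulr0 subr0.
have [->|jr] := eqVneq j r.
  by have := monicP mQ; rewrite lead_coefE sQ /= => ->; rewrite mulr1 subrr.
have rj : (r < j)%N by rewrite ltn_neqAle eq_sym jr.
by rewrite (nth_default 0 (leq_trans sm rj)) [Q`__]nth_default ?sQ // mulr0 subr0.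
Qed.

Definition node_poly (x : F) (r : nat) : {poly F} :=
  \prod_(l < r) ('X - (x - l%:R)%:P).

Lemma node_poly_monic x r : node_poly x r \is monic.
Proof. exact: monic_prod_XsubC. Qed.

Lemma size_node_poly x r : size (node_poly x r) = r.+1.
Proof. by rewrite size_prod_XsubC -[X in _ = X.+1]card_ord cardE enumT. Qed.

Lemma node_polyS x r : node_poly x r.+1 = node_poly x r * ('X - (x - r%:R)%:P).
Proof. by rewrite /node_poly big_ord_recr. Qed.

Lemma node_polySl x r : node_poly x r.+1 = ('X - x%:P) * node_poly (x - 1) r.
Proof.
rewrite /node_poly big_ord_recl /= subr0; congr (_ * _); apply: eq_bigr => i _.
by rewrite /bump /= add1n -natr1; congr ('X - _%:P); ring.
Qed.

(** The remainder is the interpolant of f at x, x - 1, ..., x - r, and its top coefficient is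
    Newton's divided difference at these nodes. *)
Definition divided_difference (r : nat) (x : F) f : F :=
  (f %% node_poly x r.+1)`_r.

Lemma divided_difference0 x f : divided_difference 0 x f = f.[x].
Proof.
by rewrite /divided_difference /node_poly big_ord1 subr0 modp_XsubC coefC.
Qed.

Lemma divided_differenceD r x f g :
  divided_difference r x (f + g) = divided_difference r x f + divided_difference r x g.
Proof. by rewrite /divided_difference modpD coefD. Qed.

Lemma divided_differenceZ r x a f :
  divided_difference r x (a *: f) = a * divided_difference r x f.
Proof. by rewrite /divided_difference modpZl coefZ. Qed.

(** The interpolants on the first and on the last r + 1 nodes both come from the one on all r + 2
    nodes by subtracting k times their node polynomial. These two node polynomials differ by r + 1
    times their common factor. *)
Lemma divided_differenceS r x f :
  r.+1%:R * divided_difference r.+1 x f =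
  divided_difference r x f - divided_difference r (x - 1) f.
Proof.
rewrite /divided_difference; set m := f %% node_poly x r.+2; set k := m`_r.+1.
have sm : (size m <= r.+2)%N.
  by rewrite -ltnS -(size_node_poly x r.+2) ltn_modp monic_neq0 ?node_poly_monic.
have red z w : node_poly x r.+2 = w * node_poly z r.+1 ->
    f %% node_poly z r.+1 = m - k *: node_poly z r.+1.
  move=> e; apply/esym/(modpP (q := f %/ node_poly x r.+2 * w + k%:P)).
    by rewrite mulrDl -mulrA -e mul_polyC -addrA subrKC -divp_eq.
  rewrite size_node_poly ltnS; apply/leq_sizeP => j hj; rewrite coefB coefZ.
  have [->|jr] := eqVneq j r.+1.
    have := monicP (node_poly_monic z r.+1).
    by rewrite lead_coefE size_node_poly /= => ->; rewrite mulr1 subrr.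
  have rj : (r.+2 <= j)%N by rewrite ltn_neqAle eq_sym jr.
  by rewrite !nth_default ?mulr0 ?subr0 ?size_node_poly // (leq_trans sm).
rewrite (red x _ (etrans (node_polyS _ _) (mulrC _ _))) (red _ _ (node_polySl _ _)).
rewrite -coefB.
have -> : m - k *: node_poly x r.+1 - (m - k *: node_poly (x - 1) r.+1) =
    (k * r.+1%:R) *: node_poly (x - 1) r.
  by rewrite [node_poly x _]node_polySl node_polyS -!mul_polyC -natr1; ring.
have := monicP (node_poly_monic (x - 1) r); rewrite lead_coefE size_node_poly /=.
by rewrite coefZ => ->; rewrite mulr1 mulrC.
Qed.

End Interpolation.

(** * The kernel as a finite sum over the top row *)

Section DiscreteKernel.
Variable F : numFieldType.

Definition base_poly (i m : nat) : {poly F} :=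
  if (i < m)%N then
    (m - i.+1)`!%:R^-1 *: \prod_(l < m - i.+1) ('X + (l%:R)%:P)
  else 0.

Lemma horner_base_poly i m (x : int) : (base_poly i m).[x%:~R] = base_fun F i m x.
Proof.
rewrite /base_poly /base_fun; case: ifP => _; last by rewrite horner0.
rewrite hornerZ horner_prod /rbin /pochhammer mulrC; congr (_ / _).
by apply: eq_bigr => l _; rewrite !hornerE.
Qed.

Lemma size_base_poly i m : (size (base_poly i m) <= m)%N.
Proof.
rewrite /base_poly; case: ifP => [im|_]; last by rewrite size_poly0.
rewrite (leq_trans (size_scale_leq _ _)) //.
under eq_bigr do rewrite -[_%:P]opprK -polyCN.
rewrite size_prod_XsubC.
have -> : size (index_enum 'I_(m - i.+1)) = (m - i.+1)%N.
  by rewrite -[RHS]card_ord cardE enumT.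
by lia.
Qed.

(** The factor r! turns the divided difference into an r-fold backward difference, and each backward
    difference lowers the level of [base_fun] by one. *)
Lemma divided_difference_base r m i (x : int) : (r <= m)%N ->
  r`!%:R * divided_difference r x%:~R (base_poly i m) = base_fun F i (m - r) x.
Proof.
elim: r x => [|r IH] x hr.
  by rewrite mul1r divided_difference0 horner_base_poly subn0.
rewrite factS natrM [r.+1%:R * _]mulrC -mulrA divided_differenceS mulrBr.
rewrite -[1](mulr1z 1) -rmorphB /= !IH ?(ltnW hr) //.
by rewrite -(subnSK hr) base_fun_diff.
Qed.

Definition top_poly (y : seq int) : {poly F} := \prod_(a <- y) ('X - (a%:~R)%:P).

Definition interp_coef (y : seq int) (x : int) (n : nat) (a : int) : F :=
  (size y - n)`!%:R *
  ((top_poly y %/ node_poly x%:~R (size y - n).+1).[a%:~R] /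
   (root_cofactor [seq b%:~R | b <- y] a%:~R).[a%:~R]).

(** Lagrange's formula at the top row is followed by a divided difference that descends to level n.
    On the cofactor P / (X - a) the latter equals the quotient of P at a, by [divp_horner_root]. *)
Lemma base_fun_interp (y : seq int) i x n : uniq y -> (n <= size y)%N ->
  base_fun F i n x =
  \sum_(a <- y) base_fun F i (size y) a * interp_coef y x n a.
Proof.
move=> uy ny; set t : seq F := [seq b%:~R | b <- y].
have ut : uniq t by rewrite map_inj_uniq //; exact: intr_inj.
have st : size t = size y by rewrite size_map.
rewrite -[X in base_fun F i X x](subKn ny) -divided_difference_base ?leq_subr //.
set r := (size y - n)%N.
have := size_base_poly i (size y); rewrite -[X in (_ <= X)%N]st => hs.
rewrite {1}(interpolation ut hs) /t big_map -/t.
have dd0 : divided_difference r x%:~R (0 : {poly F}) = 0.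
  by rewrite /divided_difference mod0p coef0.
rewrite (big_morph _ (divided_differenceD r x%:~R) dd0) mulr_sumr.
apply: eq_big_seq => a ay; rewrite divided_differenceZ horner_base_poly.
rewrite /interp_coef -/r -/t /top_poly -(big_map _ xpredT (fun b => 'X - b%:P)) -/t.
rewrite (prod_root_cofactor (a := a%:~R)) //; last by rewrite map_f.
rewrite (@divp_horner_root _ _ _ _ r) ?node_poly_monic ?size_node_poly //.
by rewrite -/(divided_difference _ _ _) mulrCA mulrAC -!mulrA.
Qed.

Definition discrete_kernel (y : seq int) (x1 : int) (n1 : nat)
    (x2 : int) (n2 : nat) : F :=
  - chain_fun F x2 n2 x1 n1 +
  \sum_(a <- y) chain_fun F x2 n2 a (size y) * interp_coef y x1 n1 a.

Lemma count_occupied_det (s m : nat) (x : 'I_s -> int) (n : 'I_s -> nat) (y : seq int) :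
  size y = m.+1 -> sorted >%R y -> (forall j, (1 <= n j <= m)%N) ->
  (forall i j, i != j -> (x i, n i) != (x j, n j)) ->
  (count (fun r => [forall j, occupied m x n j r]) (schemes m y))%:R =
  (size (schemes m y))%:R *
  \det (\matrix_(i < s, j < s) discrete_kernel y (x i) (n i) (x j) (n j)).
Proof.
move=> sy srt hn hd.
have uy := gt_sorted_uniq srt.
pose c : 'M[F]_(m.+1, s) := \matrix_(a, j) interp_coef y (x j) (n j) (nth 0 y a).
rewrite (@count_occupied _ _ _ _ _ _ sy srt hn hd c); last first.
  move=> i j; rewrite (base_fun_interp i (x j) uy); last by rewrite sy; have := hn j; lia.
  rewrite (big_nth 0) big_mkord sy; apply: eq_bigr => a _.
  by rewrite mxE.
(* [kernel_mx] has the two points in the opposite order, hence the transposition. *)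
rewrite -det_tr; congr (_ * \det _); apply/matrixP => i j; rewrite !mxE.
rewrite addrC /discrete_kernel; congr (_ + _); rewrite [RHS](big_nth 0) big_mkord sy.
by apply: eq_bigr => a _; rewrite !mxE.
Qed.

End DiscreteKernel.

(** * Integrals over subdivided intervals *)

Section IntervalIntegral.
Variable R : realType.
Notation mu := (@lebesgue_measure R).
Implicit Types (f h : R -> R) (a b c u v : R).

(** Meant for integrands with [velocity], which agree with a continuous function only inside a
    piece. The end points are negligible, but measurability and integrability must be carried over
    as well. *)
Lemma integrable_eq_continuous f h u v :
  {in `]u, v[, f =1 h} -> {within `[u, v], continuous h} ->
  mu.-integrable `[u, v] (EFin \o f) /\
  (\int[mu]_(t in `[u, v]) f t)%R = (\int[mu]_(t in `[u, v]) h t)%R.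
Proof.
move=> fh ch.
have ih : mu.-integrable `[u, v] (EFin \o h).
  by apply: continuous_compact_integrable => //; exact: segment_compact.
have mh : measurable_fun `]u, v[ h.
  apply: (@measurable_funS _ _ _ _ `[u, v]%classic) => //.
    exact: subset_itvW.
  by apply/measurable_EFinP; exact: (measurable_int mu).
have mf : measurable_fun `]u, v[ f.
  apply: eq_measurable_fun mh => x; rewrite inE /= => xuv.
  exact/esym/fh.
have mf' : measurable_fun `[u, v] f.
  by apply/measurable_fun_itv_bndo_bndcP/measurable_fun_itv_obnd_cbndP.
split; last by congr fine; apply: eq_integral_itv_bounded.
apply/integrableP; split; first exact/measurable_EFinP.
have /integrableP[_] := ih; congr (_ < _)%E.
apply: (@eq_integral_itv_bounded _ _ _ (fun t => `|f t|) (fun t => `|h t|)).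
- exact: measurableT_comp.
- exact: measurableT_comp.
- by move=> t ht; rewrite fh.
Qed.

Lemma itv_split a b c : a <= b -> b <= c ->
  `[a, c]%classic = `[a, b]%classic `|` `]b, c]%classic.
Proof.
move=> ab bc; apply/seteqP; split => x /=; rewrite !in_itv /=.
  by move=> /andP[ax xc]; have [xb|xb] := leP x b; [left|right]; apply/andP.
by case=> /andP[h1 h2]; apply/andP; split => //; lra.
Qed.

Lemma itv_disjoint a b c : [disjoint `[a, b]%classic & `]b, c]%classic].
Proof.
apply/disj_setPLR => x /=; rewrite !in_itv /= => /andP[_ xb].
by rewrite ltNge xb.
Qed.

Lemma integrable_itv_cat f a b c : a <= b -> b <= c ->
  mu.-integrable `[a, b] (EFin \o f) -> mu.-integrable `[b, c] (EFin \o f) ->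
  mu.-integrable `[a, c] (EFin \o f).
Proof.
move=> ab bc i1 i2.
have {}i2 : mu.-integrable `]b, c] (EFin \o f).
  by apply: integrableS i2 => // x /=; rewrite !in_itv /= => /andP[/ltW -> ->].
rewrite (itv_split ab bc); apply/integrableP.
have mf : measurable_fun (`[a, b] `|` `]b, c])%classic (EFin \o f).
  by apply/measurable_funU => //; split; exact: (measurable_int mu).
split=> //; rewrite integral_setU //.
- by rewrite lte_add_pinfty //; [case/integrableP: i1|case/integrableP: i2].
- exact: measurableT_comp.
- exact: itv_disjoint.
Qed.

Lemma Rintegral_itv_cat f a b c : a <= b -> b <= c ->
  mu.-integrable `[a, c] (EFin \o f) ->
  (\int[mu]_(t in `[a, c]) f t = \int[mu]_(t in `[a, b]) f t + \int[mu]_(t in `[b, c]) f t)%R.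
Proof.
move=> ab bc; rewrite (itv_split ab bc) => i; rewrite Rintegral_setU //; last exact: itv_disjoint.
congr (_ + _); rewrite Rintegral_itv_obnd_cbnd //.
by apply: integrableS i => //; exact: measurableU.
Qed.

Lemma path_lt_last a s : path <%R a s -> a <= last a s.
Proof.
elim: s a => [|b s IH] a //= /andP[ab /IH]; exact: le_trans (ltW ab).
Qed.

Lemma integrable_path f a s : path <%R a s ->
  (forall i, (i < size s)%N ->
     mu.-integrable `[nth 0 (a :: s) i, nth 0 s i] (EFin \o f)) ->
  mu.-integrable `[a, last a s] (EFin \o f).
Proof.
elim: s a => [|b s IH] a /= ps hi.
  rewrite set_itv1; apply: null_set_integrable => //.
  - exact: measurable_fun_set1.
  - exact: lebesgue_measure_set1.
case/andP: ps => ab ps; apply: (integrable_itv_cat (ltW ab) (path_lt_last ps)).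
  exact: (hi 0%N).
by apply: IH => // i hs; exact: (hi i.+1).
Qed.

Lemma Rintegral_path f (H : R -> R) a s : path <%R a s ->
  (forall i, (i < size s)%N ->
     mu.-integrable `[nth 0 (a :: s) i, nth 0 s i] (EFin \o f)) ->
  (forall i, (i < size s)%N ->
     (\int[mu]_(t in `[nth 0 (a :: s) i, nth 0 s i]) f t)%R =
       H (nth 0 s i) - H (nth 0 (a :: s) i)) ->
  (\int[mu]_(t in `[a, last a s]) f t)%R = H (last a s) - H a.
Proof.
elim: s a => [|b s IH] a /= ps hi hH.
  by rewrite set_itv1 Rintegral_set1 subrr.
have i := integrable_path (s := b :: s) ps hi.
case/andP: ps => ab ps; rewrite (Rintegral_itv_cat (ltW ab) (path_lt_last ps) i).
rewrite (hH 0%N) //= IH //; first by rewrite addrC subrKA.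
- by move=> j hj; exact: (hi j.+1).
- by move=> j hj; exact: (hH j.+1).
Qed.

Lemma path_bounds a s i : path <%R a s -> (i < size s)%N ->
  [/\ a <= nth 0 (a :: s) i, nth 0 (a :: s) i < nth 0 s i & nth 0 s i <= last a s].
Proof.
elim: s a i => [|b s IH] a [|i] //= /andP[ab ps] hi.
  by split=> //; exact: path_lt_last.
have [h1 h2 h3] := IH b i ps hi; split=> //; exact: le_trans (ltW ab) h1.
Qed.

End IntervalIntegral.

(** * Calculus of complex-valued curves *)

Section ComplexCurves.
Variable R : realType.
Notation C := R[i].
Notation mu := (@lebesgue_measure R).
Implicit Types (p q : R -> C) (u v : R).

Lemma Re_add (x y : C) : complex.Re (x + y) = complex.Re x + complex.Re y.
Proof. by case: x => ? ?; case: y. Qed.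

Lemma Im_add (x y : C) : complex.Im (x + y) = complex.Im x + complex.Im y.
Proof. by case: x => ? ?; case: y. Qed.

Lemma Re_mul (x y : C) :
  complex.Re (x * y) = complex.Re x * complex.Re y - complex.Im x * complex.Im y.
Proof. by case: x => ? ?; case: y. Qed.

Lemma Im_mul (x y : C) :
  complex.Im (x * y) = complex.Re x * complex.Im y + complex.Im x * complex.Re y.
Proof. by case: x => ? ?; case: y. Qed.

Definition continuous_curve p u v : Prop :=
  {within `[u, v], continuous (fun t => complex.Re (p t))} /\
  {within `[u, v], continuous (fun t => complex.Im (p t))}.

Lemma continuous_curve_cst (c : C) u v : continuous_curve (fun=> c) u v.
Proof. by split=> t; apply: cvg_cst. Qed.

Lemma continuous_curveD p q u v : continuous_curve p u v ->
  continuous_curve q u v -> continuous_curve (fun t => p t + q t) u v.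
Proof.
move=> [/subspace_continuousP p1 /subspace_continuousP p2].
move=> [/subspace_continuousP q1 /subspace_continuousP q2]; split.
- rewrite (_ : (fun t => _) =
    (fun t => complex.Re (p t)) + (fun t => complex.Re (q t))); last first.
    by apply/funext => t; rewrite Re_add.
  by apply/subspace_continuousP => t ht; apply: cvgD; [exact: p1|exact: q1].
- rewrite (_ : (fun t => _) =
    (fun t => complex.Im (p t)) + (fun t => complex.Im (q t))); last first.
    by apply/funext => t; rewrite Im_add.
  by apply/subspace_continuousP => t ht; apply: cvgD; [exact: p2|exact: q2].
Qed.

Lemma Re_mul_fun p q : (fun t => complex.Re (p t * q t)) =
    (fun t => complex.Re (p t)) * (fun t => complex.Re (q t)) -
    (fun t => complex.Im (p t)) * (fun t => complex.Im (q t)).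
Proof. by apply/funext => t; rewrite Re_mul. Qed.

Lemma Im_mul_fun p q : (fun t => complex.Im (p t * q t)) =
    (fun t => complex.Re (p t)) * (fun t => complex.Im (q t)) +
    (fun t => complex.Im (p t)) * (fun t => complex.Re (q t)).
Proof. by apply/funext => t; rewrite Im_mul. Qed.

Lemma continuous_curveM p q u v : continuous_curve p u v ->
  continuous_curve q u v -> continuous_curve (fun t => p t * q t) u v.
Proof.
move=> [/subspace_continuousP p1 /subspace_continuousP p2].
move=> [/subspace_continuousP q1 /subspace_continuousP q2].
split; rewrite ?Re_mul_fun ?Im_mul_fun; apply/subspace_continuousP => t ht.
- by apply: cvgB; apply: cvgM; [exact: p1|exact: q1|exact: p2|exact: q2].
- by apply: cvgD; apply: cvgM; [exact: p1|exact: q2|exact: p2|exact: q1].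
Qed.

Lemma Im_inv (x : C) : complex.Im x^-1 =
  - complex.Im x / (complex.Re x ^+ 2 + complex.Im x ^+ 2).
Proof. by case: x => a b /=; rewrite -mulNr. Qed.

Lemma continuous_curveV p u v : (forall t, t \in `[u, v] -> p t != 0) ->
  continuous_curve p u v -> continuous_curve (fun t => (p t)^-1) u v.
Proof.
move=> p0 [/subspace_continuousP p1 /subspace_continuousP p2].
pose a t := complex.Re (p t); pose b t := complex.Im (p t).
pose n : R -> R := a * a + b * b.
have nE t : n t = complex.Re (p t) ^+ 2 + complex.Im (p t) ^+ 2 by rewrite !expr2.
have n0 t : t \in `[u, v] -> n t != 0.
  move=> /p0; rewrite nE; case: (p t) => c d /=; apply: contra.
  by rewrite paddr_eq0 ?sqr_ge0 // !sqrf_eq0 eq_complex.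
have cn t : `[u, v]%classic t -> (fun t => (n t)^-1) @ within `[u, v] (nbhs t) --> (n t)^-1.
  move=> ht; apply: cvgV; first exact: n0.
  by apply: cvgD; apply: cvgM; by [exact: p1|exact: p2].
split.
- rewrite (_ : (fun t => _) = a * (fun t => (n t)^-1)); last first.
    by apply/funext => t; rewrite [RHS]/GRing.mul /= nE /a /b; case: (p t).
  apply/subspace_continuousP => t ht; apply: cvgM; [exact: p1|exact: cn].
- rewrite (_ : (fun t => _) = (- b) * (fun t => (n t)^-1)); last first.
    by apply/funext => t; rewrite Im_inv -nE.
  apply/subspace_continuousP => t ht; apply: cvgM; [|exact: cn].
  by apply: cvgN; exact: p2.
Qed.

(** [q] extends the derivative continuously to the closed interval; the derivative itself is
    prescribed in the interior only. *)
Definition C1_curve p q u v : Prop :=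
  [/\ derivable_oo_LRcontinuous (fun t => complex.Re (p t)) u v,
      derivable_oo_LRcontinuous (fun t => complex.Im (p t)) u v,
      continuous_curve q u v,
      {in `]u, v[, derive1 (fun t => complex.Re (p t)) =1 (fun t => complex.Re (q t))} &
      {in `]u, v[, derive1 (fun t => complex.Im (p t)) =1 (fun t => complex.Im (q t))}].

Lemma C1_curve_continuous p q u v : C1_curve p q u v -> continuous_curve p u v.
Proof.
by case=> h1 h2 _ _ _; split; apply: derivable_oo_LRcontinuous_within.
Qed.

Lemma C1_curveM p p' q q' u v : C1_curve p p' u v -> C1_curve q q' u v ->
  C1_curve (fun t => p t * q t) (fun t => p' t * q t + p t * q' t) u v.
Proof.
move=> hp hq; have cp := C1_curve_continuous hp; have cq := C1_curve_continuous hq.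
case: hp => -[p1 p2 p3] [p4 p5 p6] p7 p8 p9.
case: hq => -[q1 q2 q3] [q4 q5 q6] q7 q8 q9.
split.
- rewrite Re_mul_fun; split.
  + move=> t ht; apply: derivableB; apply: derivableM.
    exact: p1. exact: q1. exact: p4. exact: q4.
  + by apply: cvgB; apply: cvgM.
  + by apply: cvgB; apply: cvgM.
- rewrite Im_mul_fun; split.
  + move=> t ht; apply: derivableD; apply: derivableM.
    exact: p1. exact: q4. exact: p4. exact: q1.
  + by apply: cvgD; apply: cvgM.
  + by apply: cvgD; apply: cvgM.
- by apply: continuous_curveD; apply: continuous_curveM.
- move=> t ht; rewrite Re_mul_fun derive1E.
  have [a1 a2 a3 a4] := And4 (p1 t ht) (p4 t ht) (q1 t ht) (q4 t ht).
  rewrite (deriveB (derivableM a1 a3) (derivableM a2 a4)).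
  rewrite (deriveM a1 a3) (deriveM a2 a4) -!derive1E p8 // p9 // q8 // q9 //.
  by rewrite Re_add /= !Re_mul /GRing.scale /=; ring.
- move=> t ht; rewrite Im_mul_fun derive1E.
  have [a1 a2 a3 a4] := And4 (p1 t ht) (p4 t ht) (q1 t ht) (q4 t ht).
  rewrite (deriveD (derivableM a1 a4) (derivableM a2 a3)).
  rewrite (deriveM a1 a4) (deriveM a2 a3) -!derive1E p8 // p9 // q8 // q9 //.
  by rewrite Im_add /= !Im_mul /GRing.scale /=; ring.
Qed.

End ComplexCurves.

(** * Contour integrals of rational functions *)

Section ContourIntegral.
Variable R : realType.
Notation C := R[i].
Notation mu := (@lebesgue_measure R).
Variable g : R -> C.
Hypothesis g_C1 : piecewise_C1 g.
Implicit Types (f : C -> C).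

(** Continuity is asked only along the curve, where [g] is continuous. This suffices for
    integrability and holds for rational functions with poles off the trace. *)
Definition regular_along f : Prop := forall u v, 0 <= u -> v <= 1 ->
  continuous_curve g u v -> continuous_curve (fun t => f (g t)) u v.

Lemma C1_pieces : exists s : seq R, [/\ path <%R 0 s, last 0 s = 1 &
  forall i, (i < size s)%N ->
    [/\ 0 <= nth 0 (0 :: s) i, nth 0 (0 :: s) i < nth 0 s i, nth 0 s i <= 1 &
        exists2 q, C1_curve g q (nth 0 (0 :: s) i) (nth 0 s i) &
          {in `]nth 0 (0 :: s) i, nth 0 s i[, velocity g =1 q}]].
Proof.
case: g_C1 => s [ps ls hs]; exists s; split=> // i hi.
have [h1 h2 h3] := path_bounds ps hi; split=> //; first by rewrite -ls.
have [[d1 [a' ca ea]] [d2 [b' cb eb]]] := hs i hi.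
exists (fun t => a' t +i* b' t); first by split.
by move=> t ht; rewrite /velocity ea // eb.
Qed.

Lemma integrable_along f : regular_along f ->
  mu.-integrable `[0, 1] (EFin \o (fun t => complex.Re (f (g t) * velocity g t))) /\
  mu.-integrable `[0, 1] (EFin \o (fun t => complex.Im (f (g t) * velocity g t))).
Proof.
move=> rf; have [s [ps ls hs]] := C1_pieces; rewrite -ls.
split; apply: integrable_path => // i /hs[u0 uv v1 [q hq vq]].
- apply: (proj1 (integrable_eq_continuous (h := fun t => complex.Re (f (g t) * q t)) _ _)).
    by move=> t /vq /= ->.
  have [_ _ cq _ _] := hq.
  exact: (continuous_curveM (rf _ _ u0 v1 (C1_curve_continuous hq)) cq).1.
- apply: (proj1 (integrable_eq_continuous (h := fun t => complex.Im (f (g t) * q t)) _ _)).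
    by move=> t /vq /= ->.
  have [_ _ cq _ _] := hq.
  exact: (continuous_curveM (rf _ _ u0 v1 (C1_curve_continuous hq)) cq).2.
Qed.

Lemma contour_integral_eq f1 f2 : (forall z, trace_of g z -> f1 z = f2 z) ->
  contour_integral g f1 = contour_integral g f2.
Proof.
move=> e; rewrite /contour_integral; congr (_ +i* _); apply: eq_Rintegral => t;
by rewrite inE /= => ht; rewrite e //; exists t.
Qed.

Lemma contour_integralD f1 f2 : regular_along f1 -> regular_along f2 ->
  contour_integral g (fun z => f1 z + f2 z) =
  contour_integral g f1 + contour_integral g f2.
Proof.
move=> /integrable_along[i1 i2] /integrable_along[j1 j2]; rewrite /contour_integral.
apply/eqP; rewrite eq_complex /=; apply/andP; split; apply/eqP.
- rewrite -RintegralD //; apply: eq_Rintegral => t _; by rewrite mulrDl Re_add.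
- rewrite -RintegralD //; apply: eq_Rintegral => t _; by rewrite mulrDl Im_add.
Qed.

Lemma contour_integralZ c f : regular_along f ->
  contour_integral g (fun z => c * f z) = c * contour_integral g f.
Proof.
move=> /integrable_along[i1 i2]; rewrite /contour_integral.
have z1 r : mu.-integrable `[0, 1]
    (EFin \o (fun t => r * complex.Re (f (g t) * velocity g t))).
  exact: (integrableZl _ r i1).
have z2 r : mu.-integrable `[0, 1]
    (EFin \o (fun t => r * complex.Im (f (g t) * velocity g t))).
  exact: (integrableZl _ r i2).
apply/eqP; rewrite eq_complex; apply/andP; split; apply/eqP.
- rewrite Re_mul /= -!RintegralZl // -RintegralB //.
  by apply: eq_Rintegral => t _; rewrite -mulrA Re_mul.
- rewrite Im_mul /= -!RintegralZl // -RintegralD //.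
  by apply: eq_Rintegral => t _; rewrite -mulrA Im_mul.
Qed.

Lemma contour_integral0 : contour_integral g (fun=> 0) = 0.
Proof.
rewrite /contour_integral; under eq_Rintegral do rewrite mul0r.
under [X in _ +i* X]eq_Rintegral do rewrite mul0r.
by rewrite Rintegral_cst //= mul0r.
Qed.

Lemma regular_cst c : regular_along (fun=> c).
Proof. by move=> u v _ _ _; exact: continuous_curve_cst. Qed.

Lemma regular_id : regular_along id.
Proof. by []. Qed.

Lemma regularD f1 f2 : regular_along f1 -> regular_along f2 ->
  regular_along (fun z => f1 z + f2 z).
Proof. by move=> h1 h2 u v *; apply: continuous_curveD; [apply: h1|apply: h2]. Qed.

Lemma regularM f1 f2 : regular_along f1 -> regular_along f2 ->
  regular_along (fun z => f1 z * f2 z).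
Proof. by move=> h1 h2 u v *; apply: continuous_curveM; [apply: h1|apply: h2]. Qed.

Lemma regular_inv_sub a : ~ trace_of g a -> regular_along (fun z => (z - a)^-1).
Proof.
move=> ha u v u0 v1 cg; apply: continuous_curveV.
  move=> t /itvP ht; rewrite subr_eq0; apply/eqP => gta; apply: ha; exists t => //=.
  by rewrite in_itv /=; apply/andP; split;
    [apply: le_trans u0 _|apply: le_trans v1]; rewrite ht.
by apply: continuous_curveD => //; exact: continuous_curve_cst.
Qed.

Lemma regular_sum (I : Type) (r : seq I) (F : I -> C -> C) :
  (forall i, regular_along (F i)) -> regular_along (fun z => \sum_(i <- r) F i z).
Proof.
move=> hF; elim: r => [|i r IH].
  by under eq_fun do rewrite big_nil; exact: regular_cst.
by under eq_fun do rewrite big_cons; exact: (regularD (hF i) IH).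
Qed.

Lemma contour_integral_sum (I : Type) (r : seq I) (F : I -> C -> C) :
  (forall i, regular_along (F i)) ->
  contour_integral g (fun z => \sum_(i <- r) F i z) =
  \sum_(i <- r) contour_integral g (F i).
Proof.
move=> hF; elim: r => [|i r IH].
  by under eq_fun do rewrite big_nil; rewrite big_nil contour_integral0.
under eq_fun do rewrite big_cons; rewrite big_cons contour_integralD ?IH //.
exact: regular_sum.
Qed.

Lemma regular_exp n : regular_along (fun z => z ^+ n).
Proof.
elim: n => [|n IH]; first exact: regular_cst.
by under eq_fun do rewrite exprS; exact: (regularM regular_id IH).
Qed.

Lemma C1_curve_exp q u v n : C1_curve g q u v ->
  C1_curve (fun t => g t ^+ n.+1) (fun t => n.+1%:R * g t ^+ n * q t) u v.
Proof.
move=> hq; elim: n => [|n IH].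
  rewrite (_ : (fun t => 1%:R * _ * _) = q); first exact: hq.
  by apply/funext => t; rewrite expr0 !mul1r.
rewrite (_ : (fun t => n.+2%:R * _ * _) =
  (fun t => q t * g t ^+ n.+1 + g t * (n.+1%:R * g t ^+ n * q t))).
  under [X in C1_curve X]eq_fun do rewrite exprS.
  exact: C1_curveM.
by apply/funext => t; rewrite -[n.+2%:R]natr1 exprS; ring.
Qed.

(** With the primitive z^(n+1), the fundamental theorem of calculus applies on each piece and the
    contributions telescope. *)
Lemma contour_integral_exp n :
  contour_integral g (fun z => n.+1%:R * z ^+ n) = g 1 ^+ n.+1 - g 0 ^+ n.+1.
Proof.
have rf : regular_along (fun z => n.+1%:R * z ^+ n).
  by apply: regularM; [exact: regular_cst|exact: regular_exp].
have [s [ps ls hs]] := C1_pieces.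
have [i1 i2] := integrable_along rf.
apply/eqP; rewrite eq_complex; apply/andP; split; apply/eqP; rewrite /contour_integral [LHS]/=.
- have -> : complex.Re (g 1 ^+ n.+1 - g 0 ^+ n.+1) =
      complex.Re (g 1 ^+ n.+1) - complex.Re (g 0 ^+ n.+1).
    by rewrite Re_add; case: (g 0 ^+ n.+1).
  rewrite -ls.
  apply: (Rintegral_path (H := fun t => complex.Re (g t ^+ n.+1))) => //
    i /hs[u0 uv v1 [q hq vq]].
    apply: integrableS i1 => //; move=> t /=; rewrite !in_itv /= => /andP[h1 h2].
    by rewrite (le_trans u0 h1) (le_trans h2 v1).
  have [d1 _ c1 e1 _] := C1_curve_exp n hq.
  have [_ ->] := integrable_eq_continuous
    (f := fun t => complex.Re (n.+1%:R * g t ^+ n * velocity g t))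
    (h := fun t => complex.Re (n.+1%:R * g t ^+ n * q t)) (fun t ht =>
      congr1 (fun w => complex.Re (n.+1%:R * g t ^+ n * w)) (vq t ht)) c1.1.
  by rewrite /Rintegral (continuous_FTC2 uv c1.1 d1 e1).
- have -> : complex.Im (g 1 ^+ n.+1 - g 0 ^+ n.+1) =
      complex.Im (g 1 ^+ n.+1) - complex.Im (g 0 ^+ n.+1).
    by rewrite Im_add; case: (g 0 ^+ n.+1).
  rewrite -ls.
  apply: (Rintegral_path (H := fun t => complex.Im (g t ^+ n.+1))) => //
    i /hs[u0 uv v1 [q hq vq]].
    apply: integrableS i2 => //; move=> t /=; rewrite !in_itv /= => /andP[h1 h2].
    by rewrite (le_trans u0 h1) (le_trans h2 v1).
  have [_ d1 c1 _ e1] := C1_curve_exp n hq.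
  have [_ ->] := integrable_eq_continuous
    (f := fun t => complex.Im (n.+1%:R * g t ^+ n * velocity g t))
    (h := fun t => complex.Im (n.+1%:R * g t ^+ n * q t)) (fun t ht =>
      congr1 (fun w => complex.Im (n.+1%:R * g t ^+ n * w)) (vq t ht)) c1.2.
  by rewrite /Rintegral (continuous_FTC2 uv c1.2 d1 e1).
Qed.

Hypothesis g_closed : g 0 = g 1.

Lemma regular_horner (p : {poly C}) : regular_along (horner p).
Proof.
rewrite (_ : horner p = fun z => \sum_(i < size p) p`_i * z ^+ i); last first.
  by apply/funext => z; rewrite horner_coef.
apply: regular_sum => i; apply: regularM; [exact: regular_cst|exact: regular_exp].
Qed.

Lemma contour_integral_horner (p : {poly C}) : contour_integral g (horner p) = 0.
Proof.
rewrite (_ : horner p = fun z =>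
    \sum_(i < size p) (p`_i / i.+1%:R) * (i.+1%:R * z ^+ i)); last first.
  apply/funext => z; rewrite horner_coef; apply: eq_bigr => i _.
  by rewrite mulrA divfK // pnatr_eq0.
have rm i : regular_along (fun z => i.+1%:R * z ^+ i).
  by apply: regularM; [exact: regular_cst|exact: regular_exp].
rewrite contour_integral_sum => [|i]; last by apply: regularM => //; exact: regular_cst.
rewrite big1 // => i _; rewrite contour_integralZ // contour_integral_exp.
by rewrite g_closed subrr mulr0.
Qed.

Lemma two_pi_i_neq0 : two_pi_i R != 0.
Proof.
by rewrite eq_complex /= eqxx /= mulf_neq0 ?pnatr_eq0 // gt_eqF // pi_gt0.
Qed.

Lemma contour_integral_inv_sub a :
  contour_integral g (fun z => (z - a)^-1) = two_pi_i R * winding_number g a.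
Proof. by rewrite mulrA mulfV ?two_pi_i_neq0 // mul1r. Qed.

(** Residue theorem for simple poles. Interpolating the remainder of p at the poles is the partial
    fraction decomposition; the quotient is a polynomial and integrates to 0 over the closed
    curve. *)
Lemma contour_integral_frac (t : seq C) (p : {poly C}) : uniq t ->
  (forall a, a \in t -> ~ trace_of g a) ->
  contour_integral g (fun z => p.[z] / \prod_(a <- t) (z - a)) =
  two_pi_i R * \sum_(a <- t) winding_number g a * (p.[a] / (root_cofactor t a).[a]).
Proof.
move=> ut ht; set P : {poly C} := \prod_(a <- t) ('X - a%:P).
have mP : P \is monic by exact: monic_prod_XsubC.
have hP z : P.[z] = \prod_(a <- t) (z - a).
  by rewrite horner_prod; apply: eq_bigr => a _; rewrite hornerXsubC.
have sr : (size (p %% P)%R <= size t)%N.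
  by rewrite -ltnS -(size_prod_XsubC t id) ltn_modp monic_neq0.
(* The default 0 outside [t] makes [F a] regular for every a, as [contour_integral_sum] asks. *)
pose F a z : C := p.[a] / (root_cofactor t a).[a] * (if a \in t then (z - a)^-1 else 0).
have rF a : regular_along (F a).
  apply: regularM; first exact: regular_cst.
  by case: (boolP (a \in t)) => [/ht|_]; [exact: regular_inv_sub|exact: regular_cst].
rewrite (contour_integral_eq (f2 := fun z => (p %/ P).[z] + \sum_(a <- t) F a z)).
  rewrite contour_integralD; [|exact: regular_horner|exact: regular_sum].
  rewrite contour_integral_horner add0r contour_integral_sum // mulr_sumr.
  apply: eq_big_seq => a ta; rewrite /F ta contour_integralZ; last exact/regular_inv_sub/ht.
  by rewrite contour_integral_inv_sub mulrCA [X in _ * X]mulrC.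
move=> z hz.
have zt a : a \in t -> z - a != 0.
  by move=> ta; rewrite subr_eq0; apply/eqP => e; case: (ht a ta); rewrite -e.
have Pz0 : P.[z] != 0 by rewrite hP prodf_seq_neq0; apply/allP.
rewrite -hP {1}(divp_eq p P) hornerD hornerM mulrDl mulfK //; congr (_ + _).
rewrite {1}(interpolation ut sr) horner_sum mulr_suml.
apply: eq_big_seq => a ta; rewrite hornerZ /F ta horner_mod; last first.
  by rewrite root_prod_XsubC.
rewrite -mulrA; congr (_ * _); apply/(canLR (mulfK Pz0)).
rewrite /P (prod_root_cofactor ut ta) hornerM hornerXsubC mulrA mulVf ?mul1r //.
exact: zt.
Qed.

End ContourIntegral.

(** * Arrays as lists of rows *)

Section Arrays.
Variable m : nat.
Notation N := m.+1.
Notation array := (array N).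

Lemma siteP (r j : nat) : (1 <= j <= r)%N -> (r <= N)%N ->
  exists p : site N, row_of p = r /\ pos_of p = j.
Proof.
move=> /andP[j1 jr] rN.
have hr : (r < N.+1)%N by []. have hj : (j < N.+1)%N by exact: leq_ltn_trans jr hr.
have hp : (1 <= (Ordinal hr, Ordinal hj).2 <= (Ordinal hr, Ordinal hj).1)%N.
  by rewrite /= j1 jr.
by exists (exist _ (Ordinal hr, Ordinal hj) hp).
Qed.

Lemma site_bounds (p : site N) :
  [/\ (1 <= pos_of p)%N, (pos_of p <= row_of p)%N & (row_of p <= N)%N].
Proof. by have /andP[h1 h2] := valP p; split=> //; rewrite -ltnS ltn_ord. Qed.

Lemma site_inj (p q : site N) : row_of p = row_of q -> pos_of p = pos_of q -> p = q.
Proof.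
case: p q => -[r j] hp [[r' j'] hq] /= e1 e2; apply: val_inj => /=.
by congr (_, _); apply: val_inj.
Qed.

Definition entry (X : array) (r j : nat) : int :=
  if [pick p : site N | (row_of p == r) && (pos_of p == j)] is Some p
  then X p else 0.

Lemma entryE (X : array) (p : site N) : entry X (row_of p) (pos_of p) = X p.
Proof.
rewrite /entry; case: pickP => [q /andP[/eqP e1 /eqP e2]|/(_ p)]; last by rewrite !eqxx.
by rewrite (site_inj e1 e2).
Qed.

(* Row [N - i] of the array, so that [rows_of X 0] is the top row. *)
Definition rows_of (X : array) (i : nat) : seq int :=
  [seq entry X (N - i) j.+1 | j <- iota 0 (N - i)].

Lemma size_rows_of X i : size (rows_of X i) = (N - i)%N.
Proof. by rewrite size_map size_iota. Qed.

Lemma nth_rows_of (X : array) (p : site N) :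
  nth 0 (rows_of X (N - row_of p)) (pos_of p).-1 = X p.
Proof.
have [h1 h2 h3] := site_bounds p.
by rewrite (nth_map 0%N) ?nth_iota ?size_iota ?subKn ?prednK ?add0n ?entryE.
Qed.

Lemma mem_rows_of (X : array) (x : int) (n : nat) : (1 <= n <= N)%N ->
  (x \in rows_of X (N - n)) <-> particle_at X x n.
Proof.
move=> /andP[n1 n2]; rewrite /particle_at; split.
  move=> /mapP[j]; rewrite mem_iota subKn // => hj ->.
  have [||p [e1 e2]] := @siteP n j.+1; [lia|lia|].
  by exists p => //; rewrite -entryE e1 e2.
move=> [p e1 <-]; have [h1 h2 h3] := site_bounds p.
rewrite -nth_rows_of e1; apply: mem_nth; rewrite size_rows_of subKn //; lia.
Qed.

Lemma interlacing_rows (X : array) : interlacing X <->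
  forall i, (i < m)%N -> interlace (rows_of X i) (rows_of X i.+1).
Proof.
split=> [hX i im|hX p q e].
  apply/interlaceP; split=> [|j]; rewrite !size_rows_of; first by lia.
  move=> hj.
  have [||p [p1 p2]] := @siteP (N - i.+1) j.+1; [lia|lia|].
  have [||q [q1 q2]] := @siteP (N - i) j.+1; [lia|lia|].
  have [||q' [q1' q2']] := @siteP (N - i) j.+2; [lia|lia|].
  have Ep : nth 0 (rows_of X i.+1) j = X p.
    by rewrite -nth_rows_of p1 p2 subKn //; lia.
  have Eq : nth 0 (rows_of X i) j = X q.
    by rewrite -nth_rows_of q1 q2 subKn //; lia.
  have Eq' : nth 0 (rows_of X i) j.+1 = X q'.
    by rewrite -nth_rows_of q1' q2' subKn //; lia.
  have [|_ h1] := hX p q; first by rewrite p1 q1; lia.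
  have [|h2 _] := hX p q'; first by rewrite p1 q1'; lia.
  by rewrite Ep Eq Eq' h1 ?h2 //; rewrite ?p2 ?q2 ?q2'.
have [p1 p2 p3] := site_bounds p; have [q1 q2 q3] := site_bounds q.
have /hX/interlaceP[_] : (N - row_of q < m)%N by lia.
have -> : (N - row_of q).+1 = (N - row_of p)%N by lia.
move=> /(_ (pos_of p).-1); rewrite size_rows_of nth_rows_of => /(_ _)/andP[|h1 h2]; first by lia.
split=> e'.
  by move: h1; rewrite prednK // -[X in nth _ _ X]/((pos_of p).+1.-1) -e' nth_rows_of.
by move: h2; rewrite -e' nth_rows_of.
Qed.

Definition array_of (y : seq int) (r : seq (seq int)) : array :=
  [ffun p => nth 0 (nth [::] (y :: r) (N - row_of p)) (pos_of p).-1].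

Variable y : seq int.
Hypothesis size_y : size y = N.

Lemma size_scheme_row r i : path interlace y r -> (i <= size r)%N ->
  size (nth [::] (y :: r) i) = (N - i)%N.
Proof.
move=> pr; elim: i => [|i IH] hi; first by rewrite subn0.
have /(pathP [::])/(_ i hi)/interlaceP[e _] := pr.
by rewrite subnS -IH ?(ltnW hi) // e.
Qed.

Lemma rows_of_array_of r i : r \in schemes m y -> (i <= m)%N ->
  rows_of (array_of y r) i = nth [::] (y :: r) i.
Proof.
rewrite mem_schemes => /andP[/eqP sr pr] im.
have si := size_scheme_row pr (i := i); rewrite sr in si.
apply: (@eq_from_nth _ 0); rewrite size_rows_of ?si // => j hj.
have [||p [e1 e2]] := @siteP (N - i) j.+1; [lia|lia|].
rewrite (nth_map 0%N) ?size_iota // nth_iota // add0n -e1 -e2 entryE ffunE e1 e2.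
by rewrite subKn //; lia.
Qed.

Lemma array_of_inj : {in schemes m y &, injective (array_of y)}.
Proof.
move=> r r' hr hr' e.
have s1 : size r = m by move: hr; rewrite mem_schemes => /andP[/eqP].
have s2 : size r' = m by move: hr'; rewrite mem_schemes => /andP[/eqP].
apply: (@eq_from_nth _ [::]); rewrite s1 ?s2 // => i hi.
by rewrite -[LHS](rows_of_array_of (i := i.+1) hr) // e rows_of_array_of.
Qed.

Lemma arraysP (X : array) :
  (rows_of X 0 = y /\ interlacing X) <-> X \in [seq array_of y r | r <- schemes m y].
Proof.
split=> [[ty /interlacing_rows iX]|/mapP[r hr ->]].
  pose r := [seq rows_of X i.+1 | i <- iota 0 m].
  have nr i : (i <= m)%N -> nth [::] (y :: r) i = rows_of X i.
    case: i => [|i] hi /=; first by rewrite ty.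
    by rewrite (nth_map 0%N) ?size_iota // nth_iota.
  have hr : r \in schemes m y.
    rewrite mem_schemes size_map size_iota eqxx; apply/(pathP [::]) => i.
    rewrite size_map size_iota => hi; rewrite nr ?(ltnW hi) //.
    rewrite -[nth _ r i]/(nth [::] (y :: r) i.+1) nr //; exact: iX.
  apply/mapP; exists r => //; apply/ffunP => p; rewrite ffunE nr ?nth_rows_of //.
  by have [] := site_bounds p; lia.
split; first by rewrite rows_of_array_of.
apply/interlacing_rows => i hi; rewrite !rows_of_array_of ?(ltnW hi) //.
by move: hr; rewrite mem_schemes => /andP[/eqP sr /(pathP [::])]; apply; rewrite sr.
Qed.

(** The arrays are the injective image of a duplicate-free list, so the sets are finite, [fset_set]
    keeps their elements, and cardinals become counts in the list. *)
Lemma uniform_probability_count (R : realType) (S E : set array)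
    (P : pred (seq (seq int))) :
  (forall X, S X <-> X \in [seq array_of y r | r <- schemes m y]) ->
  (forall r, r \in schemes m y -> E (array_of y r) <-> P r) ->
  uniform_probability R S E = (count P (schemes m y))%:R / (size (schemes m y))%:R.
Proof.
move=> hS hE.
have key (Q : pred (seq (seq int))) (T : set array) :
    (forall X, T X <-> X \in [seq array_of y r | r <- schemes m y & Q r]) ->
    #|` fset_set T|%fset = count Q (schemes m y).
  move=> hT.
  have -> : T = [set` [fset X in [seq array_of y r | r <- schemes m y & Q r]]%fset].
    by apply/seteqP; split => X /=; rewrite inE /= hT.
  rewrite set_fsetK card_fseq undup_id ?size_map ?size_filter //.
  rewrite map_inj_in_uniq ?filter_uniq ?uniq_schemes // => r r'.
  by rewrite !mem_filter => /andP[_ h1] /andP[_ h2]; exact: array_of_inj.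
rewrite /uniform_probability (key P) => [|X]; last first.
  split=> [[/hS/mapP[r hr ->] /hE hP]|/mapP[r]].
    by apply: map_f; rewrite mem_filter hP.
  rewrite mem_filter => /andP[hP hr] ->; split; last exact/hE.
  by apply/hS/map_f.
rewrite (key predT) ?count_predT // => X.
by rewrite filter_predT hS.
Qed.

Hypothesis sorted_y : sorted >%R y.

(** A strictly decreasing list is determined by its set of values. *)
Lemma has_top_rowP (k : nat) (A B : nat -> rat) (X : array) :
  (forall x : int, x \in y <->
     exists2 i : nat, (1 <= i <= k)%N & A i + 2^-1 <= x%:~R <= B i - 2^-1) ->
  has_top_row k A B X <-> rows_of X 0 = y.
Proof.
move=> hy; have memT x : (x \in rows_of X 0) <-> exists2 p : site N, row_of p = N & X p = x.
  by have := @mem_rows_of X x N; rewrite subnn; apply; rewrite leqnn.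
split=> [[h1 h2]|e].
  apply: (irr_sorted_eq gt_int_trans (@ltxx _ _)) => //.
    apply/(sortedP 0) => j; rewrite size_rows_of subn0 => hj.
    have [||p [p1 p2]] := @siteP N j.+1; [lia|lia|].
    have [||q [q1 q2]] := @siteP N j.+2; [lia|lia|].
    have := h1 p q p1 q1; rewrite p2 q2 ltnSn => /(_ isT).
    by rewrite -!nth_rows_of p1 q1 p2 q2 subnn.
  move=> x; apply/idP/idP; first by move/memT/h2/hy.
  by move/hy/h2/memT.
split=> [p q p1 q1 pq|x]; last by rewrite -hy -e; exact: iff_sym.
have [a1 a2 a3] := site_bounds p; have [b1 b2 b3] := site_bounds q.
rewrite -!nth_rows_of p1 q1 subnn e.
apply: (sorted_ltn_nth gt_int_trans) => //; rewrite ?inE ?size_y; lia.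
Qed.

(** Dropping the last entry at each level is allowed, since z_j = y_j satisfies the weak upper
    bound. So one may divide by the number of arrays. *)
Lemma schemes_gt0 : (0 < size (schemes m y))%N.
Proof.
pose r := [seq take (m - i) y | i <- iota 0 m].
suff : r \in schemes m y by case: schemes.
have nr i : (i <= m)%N -> nth [::] (y :: r) i = take (N - i) y.
  case: i => [|i] hi /=; first by rewrite take_oversize // size_y subn0.
  by rewrite (nth_map 0%N) ?size_iota // nth_iota.
rewrite mem_schemes size_map size_iota eqxx; apply/(pathP [::]) => i.
rewrite size_map size_iota => hi; rewrite nr ?(ltnW hi) //.
rewrite -[nth _ r i]/(nth [::] (y :: r) i.+1) nr //.
apply/interlaceP; rewrite !size_takel ?size_y; [|lia|lia].
split=> [|j hj]; first by lia.
rewrite !nth_take; [|lia..]; rewrite lexx andbT.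
by move/(sortedP 0)/(_ j): sorted_y; apply; rewrite size_y; lia.
Qed.

End Arrays.

(** * The top row of the polygon *)

Section TopRow.
Variables (A B : nat -> rat).

Definition top_block (i : nat) : seq int :=
  [seq Num.floor (A i + 2^-1) + l%:Z | l <- iota 0 (Num.truncn (B i - A i))].

(** The last block comes first and each block is reversed, giving the decreasing order x^N_1 > x^N_2
    > ... *)
Fixpoint top_row (k : nat) : seq int :=
  if k is k'.+1 then rev (top_block k) ++ top_row k' else [::].

Lemma half_integer_floor a : half_integer a -> (Num.floor (a + 2^-1))%:~R = a + 2^-1.
Proof.
move=> ha; apply: floorK; rewrite (_ : a + _ = (a - 2^-1) + 1); last by field.
by rewrite rpredD.
Qed.

Lemma truncn_half_integer_sub a b : half_integer a -> half_integer b -> a < b ->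
  (Num.truncn (b - a))%:R = b - a.
Proof.
move=> ha hb ab; apply: truncnK; rewrite natrEint subr_ge0 (ltW ab) andbT.
rewrite (_ : b - a = (b - 2^-1) - (a - 2^-1)); last by field.
exact: rpredB.
Qed.

Variable K : nat.
Hypothesis hA : forall i : nat, (1 <= i <= K)%N -> half_integer (A i).
Hypothesis hB : forall i : nat, (1 <= i <= K)%N -> half_integer (B i).
Hypothesis hAB : forall i : nat, (1 <= i <= K)%N -> A i < B i.
Hypothesis hBA : forall i : nat, (1 <= i < K)%N -> B i < A i.+1.

Lemma mem_top_block i (x : int) : (1 <= i <= K)%N ->
  (x \in top_block i) = (A i + 2^-1 <= x%:~R <= B i - 2^-1).
Proof.
move=> hi; have eA := half_integer_floor (hA hi).
have eB := truncn_half_integer_sub (hA hi) (hB hi) (hAB hi).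
have -> : B i - 2^-1 = (Num.floor (A i + 2^-1) + (Num.truncn (B i - A i))%:Z - 1)%:~R.
  by rewrite rmorphB rmorphD /= eA -pmulrn eB; field.
rewrite -{1}eA !ler_int /top_block; move: (Num.floor _) (Num.truncn _) => a l.
apply/mapP/idP => [[j]|h]; first by rewrite mem_iota; lia.
by exists (absz (x - a)%R); rewrite ?mem_iota; lia.
Qed.

Lemma mem_top_row k (x : int) : (k <= K)%N ->
  x \in top_row k <->
  exists2 i : nat, (1 <= i <= k)%N & A i + 2^-1 <= x%:~R <= B i - 2^-1.
Proof.
elim: k => [|k IH] hk /=; first by split=> [//|[i hi]]; lia.
rewrite mem_cat mem_rev mem_top_block //; split.
  by case/orP => [h|/(IH (ltnW hk))[i hi h]]; [exists k.+1 => //; lia|exists i => //; lia].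
case=> i hi h; have [e|ne] := eqVneq i k.+1; first by rewrite -e h.
by apply/orP; right; apply/(IH (ltnW hk)); exists i => //; lia.
Qed.

Lemma size_top_row k : (k <= K)%N ->
  (size (top_row k))%:R = \sum_(1 <= i < k.+1) (B i - A i).
Proof.
elim: k => [|k IH] hk; first by rewrite big_geq.
have hi : (1 <= k.+1 <= K)%N by [].
rewrite big_nat_recr //= size_cat size_rev size_map size_iota natrD.
by rewrite (truncn_half_integer_sub (hA hi) (hB hi) (hAB hi)) IH 1?addrC // ltnW.
Qed.

Lemma top_row_le k (x : int) : (k <= K)%N -> x \in top_row k -> x%:~R <= B k - 2^-1.
Proof.
elim: k => // k IH hk; rewrite mem_cat mem_rev mem_top_block //.
case/orP => [/andP[] //|hx].
have h1 := IH (ltnW hk) hx.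
case: k IH hk hx h1 => // k IH hk hx h1.
have h2 := @hBA k.+1 (ltac:(lia)); have h3 := @hAB k.+2 (ltac:(lia)).
lra.
Qed.

Lemma top_row_sorted k : (k <= K)%N -> sorted >%R (top_row k).
Proof.
rewrite (sorted_pairwise gt_int_trans); elim: k => // k IH hk.
rewrite [top_row _]/= pairwise_cat IH ?(ltnW hk) // andbT; apply/andP; split.
  apply/allrelP => x y; rewrite mem_rev mem_top_block // => /andP[h1 _] hy.
  have h2 := top_row_le (ltnW hk) hy; suff : (y%:~R < x%:~R :> rat) by rewrite ltr_int.
  case: k IH hk hy h2 => // k IH hk hy h2 in h1 *.
  by have h3 := @hBA k.+1 (ltac:(lia)); lra.
rewrite -(sorted_pairwise gt_int_trans) rev_sorted /top_block.
rewrite (sorted_map) /=; apply: sub_sorted (iota_ltn_sorted 0 _) => i j /=; lia.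
Qed.

Lemma prod_top_row (R : realType) k (w : R[i]) : (k <= K)%N ->
  \prod_(1 <= i < k.+1) pochhammer (ratr (A i + 2^-1) - w) (Num.truncn (B i - A i)) =
  \prod_(a <- top_row k) (a%:~R - w).
Proof.
elim: k => [|k IH] hk; first by rewrite big_geq // big_nil.
rewrite big_nat_recr //= IH ?(ltnW hk) // big_cat /= mulrC; congr (_ * _).
rewrite (perm_big _ (permEl (perm_rev _))) /= big_map -[X in iota 0 X]subn0 -/(index_iota 0 _).
rewrite big_mkord /pochhammer; apply: eq_bigr => l _.
rewrite -{1}(half_integer_floor (hA (i := k.+1) _)) // ratr_int rmorphD /= -pmulrn.
ring.
Qed.

End TopRow.

(** * Evaluation of the double contour integral *)

Section Kernel.
Variable R : realType.
Notation C := R[i].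

(* The residues in w of P(w) / (Q(w) (w - z)), for Q = prod_(a <- t) (w - a),
add up to the value at z of the polynomial part of P / Q. *)
Lemma sum_residues_divp (z : C) t (P : {poly C}) : uniq (z :: t) ->
  \sum_(a <- z :: t) P.[a] / (root_cofactor (z :: t) a).[a] =
  (P %/ \prod_(a <- t) ('X - a%:P)).[z].
Proof.
move=> ut; set Q := \prod_(a <- t) _; set T := \prod_(a <- z :: t) ('X - a%:P).
have mQ : Q \is monic by exact: monic_prod_XsubC.
have sQ : size Q = (size t).+1 by exact: size_prod_XsubC.
have eT : T = ('X - z%:P) * Q by rewrite /T big_cons.
have sr : (size (P %% T)%R <= size (z :: t))%N.
  by rewrite -ltnS -(size_prod_XsubC (z :: t) id) ltn_modp monic_neq0 // monic_prod_XsubC.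
transitivity ((P %% T)`_(size t)).
  rewrite -[size t]/(size (z :: t)).-1 (coef_interpolation ut sr).
  apply: eq_big_seq => a ta; rewrite horner_mod // root_prod_XsubC //.
pose q := P %/ Q.
(* Dividing P by Q and the quotient q by X - z leaves q(z) Q + P %% Q modulo T, with top coefficient
   q(z). *)
have e : P = (q %/ ('X - z%:P)) * T + (q.[z] *: Q + P %% Q).
  rewrite {1}(divp_eq P Q) -/q {1}(divp_eq q ('X - z%:P)) modp_XsubC eT.
  by rewrite -mul_polyC; ring.
have sm : (size (P %% Q)%R <= size t)%N by rewrite -ltnS -sQ ltn_modp monic_neq0.
rewrite -(modpP e).
  rewrite coefD coefZ (nth_default 0 sm) addr0 -[size t]/(size t).+1.-1 -sQ.
  by rewrite -lead_coefE (monicP mQ) mulr1.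
rewrite size_prod_XsubC /= ltnS (leq_trans (size_polyD _ _)) // geq_max.
by rewrite (leq_trans (size_scale_leq _ _)) ?sQ // (leq_trans sm).
Qed.

Variables (k N : nat) (A B : nat -> rat) (y : seq int).
Hypothesis uniq_y : uniq y.
Hypothesis size_y : size y = N.
Hypothesis prod_y : forall w : C,
  \prod_(1 <= i < k.+1) pochhammer (ratr (A i + 2^-1) - w) (Num.truncn (B i - A i)) =
  \prod_(a <- y) (a%:~R - w).
Hypothesis le_y : forall a, a \in y -> a%:~R <= B k - 2^-1.

(** For z on its contour, the poles in w are z and the zeros of Q, all inside [gw], so every residue
    counts. The remaining function of z can have poles only at the top row. *)
Lemma corr_kernelE gz gw x1 n1 x2 n2 :
  (1 <= n1 <= N)%N -> (1 <= n2 <= N - 1)%N ->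
  admissible_contours k N B x1 n1 x2 gz gw ->
  corr_kernel k N A B gz gw x1 n1 x2 n2 = discrete_kernel C y x1 n1 x2 n2.
Proof.
move=> hn1 hn2 [[hz hw] zw hgz zinw hgw].
case: hz => z1 z2 _ _; case: hw => w1 w2 _ _.
pose P : {poly C} := top_poly C y.
pose r := (N - n1)%N.
pose Q : {poly C} := node_poly x1%:~R r.+1.
pose Zp : {poly C} := \prod_(l < N - n2 - 1) ('X - x2%:~R%:P + 1 + (l%:R)%:P).
have ZpE z : Zp.[z] = pochhammer (z - x2%:~R + 1) (N - n2 - 1).
  by rewrite /Zp horner_prod; apply: eq_bigr => l _; rewrite !hornerE.
have PE z : P.[z] = \prod_(a <- y) (z - a%:~R).
  by rewrite /P /top_poly horner_prod; apply: eq_bigr => a _; rewrite hornerXsubC.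
pose t : seq C := [seq x1%:~R - l%:R | l <- iota 0 r.+1].
have tint b : b \in t -> exists2 l : nat, (l <= r)%N & b = (x1 - l%:Z)%:~R.
  by case/mapP => l; rewrite mem_iota => hl ->; exists l => //; rewrite rmorphB.
have ut : uniq t.
  by rewrite map_inj_uniq ?iota_uniq // => i j /addrI/oppr_inj/eqP; rewrite eqr_nat => /eqP.
have QE : Q = \prod_(a <- t) ('X - a%:P).
  by rewrite big_map -[X in iota 0 X]subn0 -/(index_iota 0 _) big_mkord.
(* Each integer is inside or outside [gz], hence off its trace. This separates z from the poles in
   [t] and keeps the top row off the contour. *)
have intz (m : int) : ~ trace_of gz m%:~R by have := hgz m; case: ifP => _ [].
have inner z : trace_of gz z ->
    contour_integral gw (fun w =>
      pochhammer (z - x2%:~R + 1) (N - n2 - 1)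
        / pochhammer (w - x1%:~R) (N - n1 + 1) * (w - z)^-1
      * \prod_(1 <= i < k.+1)
          (pochhammer (ratr (A i + 2^-1) - w) (Num.truncn (B i - A i))
           / pochhammer (ratr (A i + 2^-1) - z) (Num.truncn (B i - A i)))) =
    two_pi_i R * (Zp.[z] / P.[z] * (P %/ Q).[z]).
  move=> hz; have utz : uniq (z :: t).
    rewrite cons_uniq ut andbT; apply/negP => /tint[l _ e].
    by apply: (intz (x1 - l%:Z)); rewrite -e.
  have win a : a \in z :: t -> inside gw a.
    by rewrite inE => /predU1P[->|/tint[l hl ->]]; [exact: zinw|exact: hgw].
  under eq_fun => w.
    rewrite (_ : _ * \prod_(1 <= i < k.+1) _ =
        ((Zp.[z] / P.[z]) *: P).[w] / \prod_(a <- z :: t) (w - a)); last first.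
      rewrite prodf_div !prod_y -prodf_div.
      (* The signs cancel factor by factor, so the product is P(w) / P(z). *)
      rewrite (eq_bigr (fun a => (w - a%:~R) / (z - a%:~R))); last first.
        by move=> a _; rewrite -[a%:~R - w]opprB -[a%:~R - z]opprB invrN mulrNN.
      rewrite prodf_div -!PE hornerZ big_cons ZpE.
      have -> : \prod_(a <- t) (w - a) = pochhammer (w - x1%:~R) (N - n1 + 1).
        rewrite addn1 big_map -[X in iota 0 X]subn0 -/(index_iota 0 _) big_mkord.
        by apply: eq_bigr => l _; rewrite opprB addrCA addrC.
      by rewrite invfM; ring.
    over.
  rewrite contour_integral_frac //; last by move=> a /win[].
  congr (_ * _).
  under eq_big_seq => a ta.
    have [_ ->] := win a ta; rewrite mul1r hornerZ -mulrA.
    over.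
  by rewrite -mulr_sumr sum_residues_divp // QE.
rewrite /corr_kernel (contour_integral_eq inner).
pose y' : seq C := [seq a%:~R | a <- y].
have uy' : uniq y' by rewrite map_inj_uniq //; exact: intr_inj.
under eq_fun => z.
  rewrite (_ : _ * _ =
      (two_pi_i R *: (Zp * (P %/ Q))).[z] / \prod_(a <- y') (z - a)); last first.
    rewrite hornerZ hornerM big_map -PE; ring.
  over.
rewrite contour_integral_frac //; last by move=> a /mapP[b _ ->].
rewrite /discrete_kernel; congr (_ + _).
  rewrite /chain_fun; case: ltnP => h1; last by rewrite !mul0r.
  by case: (x2 <= x1); rewrite ?mul1r ?mulr0 ?mul0r // /rbin -subnDA addn1.
rewrite big_map mulrA -[_ * two_pi_i R]mulrA expr2 mulr_sumr; apply: eq_big_seq => a ay.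
rewrite hornerZ hornerM ZpE /interp_coef size_y -/r -/P -/Q -/y'.
(* Top row points are at most B k - 1/2, so x2 <= a alone decides: the winding number is the cutoff
   in [chain_fun] at the top level. *)
have -> : winding_number gz a%:~R = (x2 <= a)%R%:R.
  by have := hgz a; rewrite (le_y ay) andbT; case: ifP => _ [].
rewrite /chain_fun; case: ltnP => h1; last by lia.
case: (x2 <= a) => /=; last by rewrite !mul0r mulr0.
rewrite /rbin mul1r -subnDA addn1 rmorphD rmorphB /=.
have tn0 := two_pi_i_neq0 R; have f0 := fact_neq0 C (N - n2.+1).
by have c0 := root_cofactor_neq0 y' a%:~R; field; rewrite c0 tn0 f0.
Qed.

End Kernel.

Theorem theorem1 (R : realType) (k N : nat) (A B : nat -> rat)
  (hk : (2 <= k)%N) (hN : (1 <= N)%N)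
  (hA : forall i : nat, (1 <= i <= k)%N -> half_integer (A i))
  (hB : forall i : nat, (1 <= i <= k)%N -> half_integer (B i))
  (hAB : forall i : nat, (1 <= i <= k)%N -> A i < B i)
  (hBA : forall i : nat, (1 <= i < k)%N -> B i < A i.+1)
  (hsum : \sum_(1 <= i < k.+1) (B i - A i) = N%:R)
  (Cz Cw : int -> nat -> int -> nat -> R -> R[i])
  (hC : forall (x1 : int) (n1 : nat) (x2 : int) (n2 : nat),
     (1 <= n1 <= N)%N -> (1 <= n2 <= N - 1)%N ->
     admissible_contours k N B x1 n1 x2 (Cz x1 n1 x2 n2) (Cw x1 n1 x2 n2))
  (s : nat) (hs : (1 <= s)%N)
  (x : 'I_s -> int) (n : 'I_s -> nat)
  (hn : forall i : 'I_s, (1 <= n i <= N - 1)%N)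
  (hdistinct : forall i j : 'I_s, i != j -> (x i, n i) != (x j, n j)) :
  (correlation R k N A B x n)%:C =
  \det (\matrix_(i < s, j < s)
          corr_kernel k N A B
            (Cz (x i) (n i) (x j) (n j)) (Cw (x i) (n i) (x j) (n j))
            (x i) (n i) (x j) (n j)).
Proof.
case: N hN hsum hC hn => // m _ hsum' hC' hn'.
pose y := top_row A B k.
have size_y : size y = m.+1.
  apply/eqP; rewrite -(eqr_nat rat) -hsum'.
  by rewrite (size_top_row hA hB hAB (leqnn k)).
have sorted_y : sorted >%R y := top_row_sorted hA hB hAB hBA (leqnn k).
have mem_y z := mem_top_row hA hB hAB z (leqnn k).
have le_y z (hz : z \in y) := top_row_le hA hB hAB hBA (leqnn k) hz.
have uniq_y := gt_sorted_uniq sorted_y.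
have n_m j : (1 <= n j <= m)%N by have := hn' j; lia.
(* The contours disappear here, which is why they may vary from one matrix entry to the next. *)
rewrite (_ : \matrix_(i, j) _ =
    \matrix_(i, j) discrete_kernel R[i] y (x i) (n i) (x j) (n j)); last first.
  apply/matrixP => i j; rewrite !mxE; apply: corr_kernelE => //.
  - by move=> w; rewrite (prod_top_row B hA w (leqnn k)).
  - by have := n_m i; lia.
  - by apply: hC'; [have := n_m i; lia|exact: hn'].
have hcount := count_occupied_det R[i] size_y sorted_y n_m hdistinct.
have size0 : (size (schemes m y))%:R != 0 :> R[i].
  by rewrite pnatr_eq0 -lt0n schemes_gt0.
rewrite /correlation (@uniform_probability_count m y size_y R _ _
  (fun r => [forall j, occupied m x n j r])) //.
- by rewrite rmorphM fmorphV !rmorph_nat hcount mulrAC mulfV ?mul1r.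
- move=> X; rewrite -(arraysP size_y); split=> -[h1 h2]; split=> //.
    exact/(has_top_rowP size_y sorted_y X mem_y).
  exact/(has_top_rowP size_y sorted_y X mem_y).
- move=> r hr; split=> [h|/forallP h j].
    apply/forallP => j; have /mem_rows_of := h j.
    have /andP[n1 n2] := n_m j; rewrite n1 ltnW // subSn // => /(_ isT).
    by rewrite (rows_of_array_of size_y hr) //; lia.
  have /andP[n1 n2] := n_m j; apply/mem_rows_of; first by rewrite n1 ltnW.
  rewrite subSn // (rows_of_array_of size_y hr); last by lia.
  exact: h.
Qed.
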